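(* Every SITAwIM $(A,\mathbf{B})$ of rank $5$ with standard basis of the form $\mathbf{B}=\{b_0,b_1,b_1^*,b_3,b_3^*\}$, where $b_1^*\ne b_1$ and $b_3^*\ne b_3$ (two distinct asymmetric pairs), has cyclotomic eigenvalues, i.e. all eigenvalues of the regular matrices of the elements of $\mathbf{B}$ are cyclotomic.
   Context: An integral table algebra $(A,\mathbf{B})$ is a finite-dimensional complex algebra $A$ with involution $*$ and a $*$-invariant basis $\mathbf{B}=\{b_0=1,\dots,b_{r-1}\}$ with nonnegative integer structure constants satisfying the pseudo-inverse condition (the coefficient of $1$ in $b_ib_j^*$ is positive iff $b_j=b_i^*$); elements of $\mathbf{B}$ are identified with their left regular matrices. It is standard if for each $b_i$ the coefficient of $1$ in $b_ib_i^*$ equals the maximal eigenvalue $\delta_i$ (degree) of $b_i$; this is a SITA of rank $r=|\mathbf{B}|$ and order $n=\sum_j\delta_j$. For commutative $A$ let $P=(\chi_i(b_j))$ be the character table, with $\chi_0(b_j)=\delta_j$; the multiplicity $m_i$ of $\chi_i$ is defined by $\sum_{j}|\chi_i(b_j)|^2/\delta_j=n/m_i$. A SITAwIM is a commutative SITA all of whose multiplicities $m_i$ are positive integers. An algebraic number is cyclotomic if it lies in a cyclotomic extension of $\mathbb{Q}$. *)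

(* Defs.v *)
From HB Require Import structures.
From mathcomp Require Import all_boot all_order all_algebra falgebra.
From mathcomp Require Import reals complex.

Set Implicit Arguments.
Unset Strict Implicit.
Unset Printing Implicit Defensive.

Import Order.TTheory GRing.Theory Num.Theory.
Local Open Scope ring_scope.

(* A basis of rank r.+1 is a tuple whose entry 0 is the identity element; the
   coefficient of b_k in x is then [coord B k x]. *)

Definition regmx (C : numClosedFieldType) (A : falgType C) (r : nat)
    (B : r.+1.-tuple A) (x : A) : 'M[C]_r.+1 :=
  \matrix_(i, j) coord B i (x * tnth B j).

Record is_involution (C : numClosedFieldType) (A : falgType C)
    (star : A -> A) : Prop := IsInvolution {
  starD : forall x y : A, star (x + y) = star x + star y;
  starZ : forall (c : C) (x : A), star (c *: x) = c^* *: star x;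
  starM : forall x y : A, star (x * y) = star y * star x;
  starK : involutive star }.

Record is_integral_table_algebra (C : numClosedFieldType) (A : falgType C)
    (star : A -> A) (r : nat) (B : r.+1.-tuple A) : Prop :=
  IsIntegralTableAlgebra {
    ita_involution : is_involution star;
    ita_basis : basis_of {:A} B;
    ita_one : tnth B ord0 = 1;
    ita_star : forall i, star (tnth B i) \in B;
    ita_integral : forall i j k,
      exists n : nat, coord B k (tnth B i * tnth B j) = n%:R;
    ita_pseudo_inverse : forall i j,
      0 < coord B ord0 (tnth B i * tnth B j) <-> tnth B j = star (tnth B i) }.

(* The eigenvalue of maximal modulus: for a nonnegative matrix, its
   Perron-Frobenius eigenvalue. The bound forces d to be real, because the order
   on C only compares numbers that differ by a real. *)
Definition maximal_eigenvalue (C : numClosedFieldType) (n : nat)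
    (M : 'M[C]_n) (d : C) : Prop :=
  eigenvalue M d /\ forall a : C, eigenvalue M a -> `|a| <= d.

Record is_SITA (C : numClosedFieldType) (A : falgType C) (star : A -> A)
    (r : nat) (B : r.+1.-tuple A) (delta : 'I_r.+1 -> C) : Prop := IsSITA {
  sita_ita : is_integral_table_algebra star B;
  sita_degree : forall i, maximal_eigenvalue (regmx B (tnth B i)) (delta i);
  sita_standard : forall i,
    coord B ord0 (tnth B i * star (tnth B i)) = delta i }.

Definition table_order (C : numClosedFieldType) (r : nat)
    (delta : 'I_r.+1 -> C) : C := \sum_j delta j.

Definition is_multiplicity (C : numClosedFieldType) (A : falgType C) (r : nat)
    (B : r.+1.-tuple A) (delta : 'I_r.+1 -> C)
    (chi : {lrmorphism A -> C | *%R}) (m : C) : Prop :=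
  \sum_j `|chi (tnth B j)| ^+ 2 / delta j = table_order delta / m.

(* The irreducible characters of a commutative A are its unital algebra
   morphisms to C. *)
Record is_SITAwIM (C : numClosedFieldType) (A : falgType C) (star : A -> A)
    (r : nat) (B : r.+1.-tuple A) (delta : 'I_r.+1 -> C) : Prop :=
  IsSITAwIM {
    sitawim_sita : is_SITA star B delta;
    sitawim_comm : commutative (@GRing.mul A);
    sitawim_mult : forall chi : {lrmorphism A -> C | *%R},
      exists2 m : nat, (0 < m)%N & is_multiplicity B delta chi m%:R }.

(* x is an element p(z) / q(z) of the field Q(z), for some root of unity z. *)
Definition is_cyclotomic (C : numClosedFieldType) (x : C) : Prop :=
  exists (n : nat) (z : C) (p q : {poly rat}),
    [/\ (0 < n)%N, n.-primitive_root z, (map_poly ratr q).[z] != 0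
      & x = (map_poly ratr p).[z] / (map_poly ratr q).[z]].

(* Main.v *)
Require Import Defs.
From HB Require Import structures.
From mathcomp Require Import all_boot all_order all_algebra falgebra.
From mathcomp Require Import reals complex.
From mathcomp Require Import cyclic separable finfield cyclotomic ring zify.

Set Implicit Arguments.
Unset Strict Implicit.
Unset Printing Implicit Defensive.

Import Order.TTheory GRing.Theory Num.Theory.
Local Open Scope ring_scope.

(* Let k and l be the degrees of b1 and b3. Besides the degree character, the
   characters form two conjugate pairs, with multiplicities m and m', and
   n = 1 + 2k + 2l = 1 + 2m + 2m'. Both the sum of all characters and the sum
   weighted by the multiplicities are rational on integral elements. If m <> m',
   then each conjugate pair has rational sums, so every character value is
   quadratic over Q. If m = m', integrality of the trace forces m | k and m | l,
   hence k = l = m, and orthogonality leaves two character tables, up to order.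
   In one the values lie in Q(sqrt n, sqrt (-n)). In the other x = a - a* and
   y = b - b*, for a and b the values at b1 and b3 of one character, satisfy
   x^2 = - (n + s w) / 2 and y^2 = - (n - s w) / 2 with w^2 = n and
   s^2 + t^2 = n for some rationals s and t; these are up to sign and a factor
   'i the half-sum and half-difference of the square roots of (s + 'i t) w and
   (s - 'i t) w. That sqrt (u |u|) is cyclotomic for every Gaussian u is
   multiplicative in u; for a prime of norm p = 1 mod 4 it holds because the
   quartic and quadratic Gauss sums satisfy g4^2 = J g2 with J a Jacobi sum of
   norm p, and g2^2 = p. *)

(** * Cyclotomic numbers *)

(** In characteristic 0 the polynomial ['X^n - 1] is separable, so it has [n] distinct roots, and
    among [n] distinct [n]-th roots of unity one is primitive. *)
Lemma closed_prim_root_exists (C : numClosedFieldType) n :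
  (n > 0)%N -> exists z : C, n.-primitive_root z.
Proof.
pose p : {poly C} := 'X^n - 1; have [r Dp] := closed_field_poly_normal p.
move=> n_gt0; rewrite (monicP _) ?monicXnsubC // scale1r in Dp.
have rn1: all n.-unity_root r by apply/allP=> z; rewrite -root_prod_XsubC -Dp.
have sz_r: (n < (size r).+1)%N.
  by rewrite -(size_prod_XsubC r id) -Dp size_XnsubC.
have [|z] := hasP (has_prim_root n_gt0 rn1 _ sz_r); last by exists z.
by rewrite -separable_prod_XsubC -Dp separable_Xn_sub_1 // pnatr_eq0 -lt0n.
Qed.

Section CyclotomicNumbers.
Variable C : numClosedFieldType.
Implicit Types (x y z : C) (p q : {poly rat}).

(** The field Q(z) for a fixed, arbitrary [z]: sums and products of cyclotomic numbers are formed
    inside one such field. *)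
Definition rational_in z x : Prop :=
  exists p q, (map_poly ratr q).[z] != 0
    /\ x = (map_poly ratr p).[z] / (map_poly ratr q).[z].

Lemma rational_inX z i x : rational_in (z ^+ i) x -> rational_in z x.
Proof.
move=> [p [q [nz ->]]]; exists (p \Po 'X^i), (q \Po 'X^i).
by rewrite !map_comp_poly !map_polyXn !horner_comp !hornerXn.
Qed.

Lemma rational_inD z x y :
  rational_in z x -> rational_in z y -> rational_in z (x + y).
Proof.
move=> [p [q [nz ->]]] [p' [q' [nz' ->]]].
exists (p * q' + p' * q), (q * q').
rewrite !(rmorphD, rmorphM) /= !(hornerD, hornerM) mulf_neq0 //; split=> //.
by field; rewrite nz nz'.
Qed.

Lemma rational_inM z x y :
  rational_in z x -> rational_in z y -> rational_in z (x * y).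
Proof.
move=> [p [q [nz ->]]] [p' [q' [nz' ->]]].
exists (p * p'), (q * q').
rewrite !rmorphM /= !hornerM mulf_neq0 //; split=> //.
by field; rewrite nz nz'.
Qed.

Lemma cyclotomicP x : is_cyclotomic x <->
  exists2 n, (0 < n)%N & exists2 z, n.-primitive_root z & rational_in z x.
Proof.
split=> [[n [z [p [q [n0 zn nz ->]]]]]|[n n0 [z zn [p [q [nz ->]]]]]].
  by exists n => //; exists z => //; exists p, q.
by exists n, z, p, q.
Qed.

(** Roots of unity of orders [n] and [m] are both powers of one primitive root of order [n * m]. *)
Lemma cyclotomic_common x y : is_cyclotomic x -> is_cyclotomic y ->
  exists n z, [/\ (0 < n)%N, n.-primitive_root z, rational_in z x
    & rational_in z y].
Proof.
move=> /cyclotomicP[n n0 [u un xu]] /cyclotomicP[m m0 [v vm yv]].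
have nm0 : (0 < n * m)%N by rewrite muln_gt0 n0.
have [z zp] := closed_prim_root_exists C nm0.
exists (n * m)%N, z; split=> //.
  have /(prim_rootP zp)[i ui] : u ^+ (n * m) = 1.
    by rewrite exprM (prim_expr_order un) expr1n.
  by apply: (@rational_inX _ i); rewrite -ui.
have /(prim_rootP zp)[i vi] : v ^+ (n * m) = 1.
  by rewrite mulnC exprM (prim_expr_order vm) expr1n.
by apply: (@rational_inX _ i); rewrite -vi.
Qed.

Lemma cyclotomicD x y :
  is_cyclotomic x -> is_cyclotomic y -> is_cyclotomic (x + y).
Proof.
move=> cx cy; have [n [z [n0 zn xz yz]]] := cyclotomic_common cx cy.
by apply/cyclotomicP; exists n => //; exists z => //; apply: rational_inD.
Qed.

Lemma cyclotomicM x y :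
  is_cyclotomic x -> is_cyclotomic y -> is_cyclotomic (x * y).
Proof.
move=> cx cy; have [n [z [n0 zn xz yz]]] := cyclotomic_common cx cy.
by apply/cyclotomicP; exists n => //; exists z => //; apply: rational_inM.
Qed.

Lemma cyclotomicV x : is_cyclotomic x -> is_cyclotomic x^-1.
Proof.
have [->|x0] := eqVneq x 0; first by rewrite invr0.
move=> [n [z [p [q [n0 zn nz e]]]]]; exists n, z, q, p; split=> //.
  by apply: contraNneq x0 => p0; rewrite e p0 mul0r.
by rewrite e invf_div.
Qed.

Lemma cyclotomic_rat r : is_cyclotomic (ratr r : C).
Proof.
have [z z1] := closed_prim_root_exists C (ltn0Sn 0).
exists 1%N, z, r%:P, 1; split=> //.
  by rewrite rmorph1 hornerC oner_eq0.
by rewrite rmorph1 map_polyC /= !hornerC divr1.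
Qed.

Lemma cyclotomic_int (m : int) : is_cyclotomic (m%:~R : C).
Proof. by rewrite -(ratr_int C); apply: cyclotomic_rat. Qed.

Lemma cyclotomic_nat m : is_cyclotomic (m%:R : C).
Proof. by rewrite pmulrn; apply: cyclotomic_int. Qed.

Lemma cyclotomicN x : is_cyclotomic x -> is_cyclotomic (- x).
Proof.
move=> cx; rewrite -mulN1r; apply: cyclotomicM cx.
exact: (cyclotomic_int (-1)).
Qed.

Lemma cyclotomicB x y :
  is_cyclotomic x -> is_cyclotomic y -> is_cyclotomic (x - y).
Proof. by move=> cx cy; apply: cyclotomicD => //; apply: cyclotomicN. Qed.

Lemma cyclotomic_div x y :
  is_cyclotomic x -> is_cyclotomic y -> is_cyclotomic (x / y).
Proof. by move=> cx cy; apply: cyclotomicM => //; apply: cyclotomicV. Qed.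

Lemma cyclotomicX x n : is_cyclotomic x -> is_cyclotomic (x ^+ n).
Proof.
move=> cx; elim: n => [|n IH]; first exact: (cyclotomic_nat 1).
by rewrite exprS; apply: cyclotomicM.
Qed.

Lemma cyclotomic_sum (I : Type) (r : seq I) (P : pred I) (F : I -> C) :
  (forall i, P i -> is_cyclotomic (F i)) ->
  is_cyclotomic (\sum_(i <- r | P i) F i).
Proof.
move=> cF; elim/big_ind: _ => //; last exact: cyclotomicD.
exact: (cyclotomic_nat 0).
Qed.

Lemma cyclotomic_unity x n : (0 < n)%N -> x ^+ n = 1 -> is_cyclotomic x.
Proof.
move=> n0 xn; have [z zn] := closed_prim_root_exists C n0.
have [i ->] := prim_rootP zn xn; apply: cyclotomicX.
apply/cyclotomicP; exists n => //; exists z => //; exists 'X, 1.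
by rewrite rmorph1 map_polyX hornerX hornerC oner_eq0 divr1.
Qed.

(** Square roots are tracked in this form because it is multiplicative in [x]; the choice of root is
    immaterial by [cyclotomic_sqrt]. *)
Definition cyclotomic_square x : Prop :=
  exists2 z, is_cyclotomic z & z ^+ 2 = x.

Lemma cyclotomic_sqrt x z :
  cyclotomic_square x -> z ^+ 2 = x -> is_cyclotomic z.
Proof.
move=> [y cy <-] /eqP; rewrite eqf_sqr => /orP[]/eqP-> //.
exact: cyclotomicN.
Qed.

Lemma cyclotomic_squareM x y : cyclotomic_square x -> cyclotomic_square y ->
  cyclotomic_square (x * y).
Proof.
move=> [u cu <-] [v cv <-]; exists (u * v); last by rewrite exprMn.
exact: cyclotomicM.
Qed.

Lemma cyclotomic_squareX2 x : is_cyclotomic x -> cyclotomic_square (x ^+ 2).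
Proof. by move=> cx; exists x. Qed.

Lemma cyclotomic_square_unity x n :
  (0 < n)%N -> x ^+ n = 1 -> cyclotomic_square x.
Proof.
move=> n0 xn; exists (sqrtC x); last by rewrite sqrtCK.
by apply: (@cyclotomic_unity _ (2 * n)); rewrite ?muln_gt0 // exprM sqrtCK.
Qed.

Lemma cyclotomic_squareN x : cyclotomic_square x -> cyclotomic_square (- x).
Proof.
rewrite -mulN1r; apply: cyclotomic_squareM.
by apply: (@cyclotomic_square_unity _ 2) => //; rewrite sqrrN expr1n.
Qed.

Lemma cyclotomic_i : is_cyclotomic ('i : C).
Proof.
apply: (@cyclotomic_unity _ 4) => //.
by rewrite (exprM _ 2 2) sqrCi sqrrN expr1n.
Qed.

End CyclotomicNumbers.
(** * Gauss and Jacobi sums over a finite field *)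

Section GaussSums.
Variables (C : numClosedFieldType) (F : finFieldType).
Implicit Types (f g psi : F -> C).

Record is_mulchar f : Prop := IsMulchar {
  mulchar0 : f 0 = 0;
  mulchar1 : f 1 = 1;
  mulcharM : {morph f : x y / x * y} }.

(** The field [addchar_sum] is the form in which nontriviality of the character is used. *)
Record is_addchar psi : Prop := IsAddchar {
  addchar0 : psi 0 = 1;
  addcharD : forall x y, psi (x + y) = psi x * psi y;
  addchar_sum : \sum_x psi x = 0 }.

Definition gauss_sum psi f : C := \sum_x f x * psi x.
Definition jacobi_sum f g : C := \sum_x f x * g (1 - x).

Lemma is_mulcharX f n :
  (0 < n)%N -> is_mulchar f -> is_mulchar (fun x => f x ^+ n).
Proof.
move=> n0 [f0 f1 fM]; split=> [||x y]; first by rewrite f0 expr0n eqn0Ngt n0.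
  by rewrite f1 expr1n.
by rewrite fM exprMn.
Qed.

Lemma sum_scale (V : nmodType) (h : F -> V) (u : F) : u != 0 ->
  \sum_x h x = \sum_x h (u * x).
Proof. by move=> u0; rewrite (reindex_inj (mulfI u0)). Qed.

Lemma mulchar_sum f u : is_mulchar f -> f u != 1 -> u != 0 -> \sum_x f x = 0.
Proof.
move=> fm fu u0; have := sum_scale f u0.
under [RHS]eq_bigr do rewrite (mulcharM fm).
rewrite -mulr_sumr => /eqP; rewrite -subr_eq0 -{1}[X in X - _]mul1r -mulrBl.
by rewrite mulf_eq0 subr_eq0 eq_sym (negPf fu) => /eqP.
Qed.

(** For [s != 0], substitute [s * x] for [x]. For [s = 0] both sides vanish, the left one because
    the product character sums to 0. *)
Lemma jacobi_shift f g s : is_mulchar f -> is_mulchar g ->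
  \sum_x f x * g x = 0 ->
  \sum_x f x * g (s - x) = f s * g s * jacobi_sum f g.
Proof.
move=> fm gm fg0; have [->|s0] := eqVneq s 0.
  rewrite (mulchar0 fm) !mul0r.
  under eq_bigr => x _ do rewrite sub0r -mulN1r (mulcharM gm) mulrCA.
  by rewrite -mulr_sumr fg0 mulr0.
rewrite (sum_scale _ s0) /jacobi_sum mulr_sumr; apply: eq_bigr => x _.
have -> : s - s * x = s * (1 - x) by ring.
by rewrite (mulcharM fm) (mulcharM gm); ring.
Qed.

(** Grouping the double sum by the sum [s] of the two arguments produces the convolution of [f] and
    [g], which [jacobi_shift] evaluates. *)
Lemma gauss_sumM psi f g : is_addchar psi -> is_mulchar f -> is_mulchar g ->
  \sum_x f x * g x = 0 ->
  gauss_sum psi f * gauss_sum psi g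
  = jacobi_sum f g * gauss_sum psi (fun x => f x * g x).
Proof.
move=> psia fm gm fg0.
transitivity (\sum_s psi s * \sum_x f x * g (s - x)); last first.
  rewrite /gauss_sum mulr_sumr; apply: eq_bigr => s _.
  by rewrite jacobi_shift //; ring.
under [RHS]eq_bigr do rewrite mulr_sumr.
rewrite exchange_big /= /gauss_sum mulr_suml; apply: eq_bigr => x _.
rewrite mulr_sumr (reindex_inj (addIr (- x))) /=; apply: eq_bigr => s _.
have -> : psi s = psi (s - x) * psi x by rewrite -(addcharD psia) subrK.
ring.
Qed.

Lemma addchar_sum_scale psi u : is_addchar psi ->
  \sum_x psi (x * u) = if u == 0 then #|F|%:R else 0.
Proof.
move=> psia; case: eqVneq => [->|u0].
  under eq_bigr do rewrite mulr0 (addchar0 psia).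
  by rewrite sumr_const.
rewrite -[RHS](addchar_sum psia) [RHS](sum_scale _ u0).
by apply: eq_bigr => x _; rewrite mulrC.
Qed.

(** Here [g] is inverse to [f], so writing the first argument as [y * t] leaves
    [f t * psi (y * (t + 1))]. Summing over [y != 0] first gives [#|F| - 1] at [t = -1] and [-1]
    elsewhere, and the [-1] terms cancel since [f] sums to 0. *)
Lemma gauss_sumV psi f g : is_addchar psi -> is_mulchar f -> is_mulchar g ->
  (forall x, f x * g x = (x != 0)%:R) -> \sum_x f x = 0 ->
  gauss_sum psi f * gauss_sum psi g = f (-1) * #|F|%:R.
Proof.
move=> psia fm gm fg f0.
transitivity (\sum_t f t * \sum_(y | y != 0) psi (y * (t + 1))).
  under [RHS]eq_bigr do rewrite mulr_sumr.
  rewrite exchange_big /= /gauss_sum mulrC mulr_suml (bigD1 0) //=.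
  rewrite (mulchar0 gm) !mul0r add0r; apply: eq_bigr => y y0.
  rewrite mulr_sumr (sum_scale _ y0); apply: eq_bigr => t _.
  rewrite (mulcharM fm) mulrDr mulr1 (addcharD psia).
  transitivity ((f y * g y) * (f t * (psi (y * t) * psi y))); first by ring.
  by rewrite fg y0 mul1r.
have sum_psi t : \sum_(y | y != 0) psi (y * (t + 1))
    = (if t == -1 then #|F|%:R else 0) - 1.
  rewrite -addr_eq0 -(addchar_sum_scale _ psia) [in RHS](bigD1 0) //=.
  by rewrite mul0r (addchar0 psia) addrAC subrr add0r.
under eq_bigr do rewrite sum_psi mulrBr mulr1.
rewrite sumrB f0 subr0 (bigD1 (-1)) //= eqxx big1 ?addr0 // => t /negPf->.
by rewrite mulr0.
Qed.

(** The unit group is cyclic; the character sends a generator [u] to [w], and the hypothesis on [w]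
    makes this independent of the exponent chosen. *)
Lemma mulchar_exists (w : C) : w ^+ #|F|.-1 = 1 -> exists f u,
  [/\ is_mulchar f, u != 0, f u = w
    & forall x, x != 0 -> exists i, f x = w ^+ i].
Proof.
move=> wN; set N := #|F|.-1 in wN.
have cardF : #|F| = N.+1 by rewrite prednK // ltnW // finNzRing_gt1.
have N0 : (0 < N)%N by rewrite -ltnS -cardF finNzRing_gt1.
have unitN (x : F) : x != 0 -> x ^+ N = 1.
  by move=> x0; apply: (mulfI x0); rewrite -exprS -cardF expf_card mulr1.
have /hasP[u _ uN] : has N.-primitive_root (enum (predC1 (0 : F))).
  apply: has_prim_root => //; last 2 first.
  - exact: enum_uniq.
  - by rewrite -cardE cardC1.
  by apply/allP => x; rewrite mem_enum unity_rootE => /unitN->.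
have u0 : u != 0.
  apply/eqP => u0; have /eqP := prim_expr_order uN.
  by rewrite u0 expr0n eqn0Ngt N0 eq_sym oner_eq0.
have logP (x : F) : x != 0 -> exists i : 'I_N, x == u ^+ i.
  by move=> /unitN/(prim_rootP uN)[i ->]; exists i.
pose f x := if [pick i : 'I_N | x == u ^+ i] is Some i then w ^+ i else 0.
have fX i : f (u ^+ i) = w ^+ i.
  (* The search for an exponent below [N] cannot fail, since [i] modulo [N] is one. *)
  rewrite /f; case: pickP => [j|/(_ (Ordinal (ltn_pmod i N0)))] /=; last first.
    by rewrite (prim_expr_mod uN) eqxx.
  rewrite (eq_prim_root_expr uN) => /eqP ij.
  by rewrite -(expr_mod i wN) ij expr_mod.
have f0 : f 0 = 0.
  rewrite /f; case: pickP => // i /eqP /esym/eqP.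
  by rewrite expf_eq0 (negPf u0) andbF.
exists f, u; split=> //.
- split=> // [|x y]; first exact: (fX 0%N).
  have [->|/logP[i /eqP->]] := eqVneq x 0; first by rewrite !(mul0r, f0).
  have [->|/logP[j /eqP->]] := eqVneq y 0; first by rewrite !(mulr0, f0).
  by rewrite -exprD !fX exprD.
- exact: (fX 1%N).
- by move=> x /logP[i /eqP->]; exists i; apply: fX.
Qed.

End GaussSums.

Lemma addchar_exists (C : numClosedFieldType) p : prime p ->
  exists psi : 'F_p -> C, is_addchar psi /\ forall x, is_cyclotomic (psi x).
Proof.
move=> p_pr; have [z zp] := closed_prim_root_exists C (prime_gt0 p_pr).
have zp1 := prim_expr_order zp.
exists (fun x => z ^+ x); split=> [|x]; last first.
  by apply: cyclotomicX; apply: (cyclotomic_unity (prime_gt0 p_pr)).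
have psiD (x y : 'F_p) : z ^+ (x + y)%R = z ^+ x * z ^+ y.
  by rewrite -exprD /= [X in (_ %% X)%N]Fp_cast // expr_mod.
split=> //.
have z1 : z ^+ (1%R : 'F_p) = z by rewrite /= modn_small ?expr1.
(* Translating by 1 multiplies the sum by [z], and [z] differs from 1. *)
have /eqP : \sum_(x : 'F_p) z ^+ x = z * \sum_(x : 'F_p) z ^+ x.
  rewrite {1}(reindex_inj (addrI 1)) mulr_sumr; apply: eq_bigr => x _.
  by rewrite psiD z1.
rewrite -subr_eq0 -{1}[X in X - _]mul1r -mulrBl mulf_eq0 subr_eq0 => /orP[|/eqP//].
rewrite eq_sym -{1}[z]expr1 -(prim_order_dvd zp) dvdn1 => /eqP p1.
by rewrite p1 in p_pr.
Qed.

(** * Square roots of rational numbers by quadratic Gauss sums *)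

Section QuadraticGaussSum.
Variable C : numClosedFieldType.

Lemma cyclotomic_gauss_sum (F : finFieldType) (psi f : F -> C) :
  (forall x, is_cyclotomic (psi x)) -> (forall x, is_cyclotomic (f x)) ->
  is_cyclotomic (gauss_sum psi f).
Proof. by move=> cp cf; apply: cyclotomic_sum => x _; apply: cyclotomicM. Qed.

Lemma cyclotomic_mulchar (F : finFieldType) (f : F -> C) w :
  is_mulchar f -> is_cyclotomic w ->
  (forall x, x != 0 -> exists i, f x = w ^+ i) -> forall x, is_cyclotomic (f x).
Proof.
move=> fm cw fP x; have [->|/fP[i ->]] := eqVneq x 0; last exact: cyclotomicX.
by rewrite (mulchar0 fm); apply: (cyclotomic_nat C 0).
Qed.

(** The factor [sqrtC 'i] is an eighth root of unity, and the square of [1 - 'i] is [- 2 * 'i]. *)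
Lemma cyclotomic_sqrt2 : exists2 z : C, is_cyclotomic z & z ^+ 2 = 2%:R.
Proof.
exists (sqrtC 'i * (1 - 'i)).
  apply: cyclotomicM; last first.
    by apply: cyclotomicB (cyclotomic_i C); apply: (cyclotomic_nat C 1).
  apply: (@cyclotomic_unity _ _ 8) => //.
  by rewrite (exprM _ 2 4) sqrtCK (exprM _ 2 2) sqrCi sqrrN expr1n.
rewrite exprMn sqrtCK sqrrB expr1n sqrCi mul1r.
transitivity ('i ^+ 2 * (- 2%:R) : C); first by ring.
by rewrite sqrCi; ring.
Qed.

(** For odd [p] the Gauss sum of the quadratic character [f] squares to [f (-1) * p], and the sign
    [f (-1)] is itself the square of a root of unity. *)
Lemma cyclotomic_square_prime p : prime p -> cyclotomic_square (p%:R : C).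
Proof.
move=> p_pr; have [->|p_odd] := even_prime p_pr.
  exact: cyclotomic_sqrt2.
have [psi [psia psic]] := addchar_exists C p_pr.
have N1 : (-1 : C) ^+ #|'F_p|.-1 = 1.
  by rewrite -signr_odd card_Fp // -subn1 oddB ?prime_gt0 // p_odd.
have [f [u [fm u0 fu fP]]] := mulchar_exists N1.
have f2 x : f x * f x = (x != 0)%:R.
  have [->|/fP[i ->]] := eqVneq x 0; first by rewrite (mulchar0 fm) mul0r.
  by rewrite -expr2 sqrr_sign.
have fc := cyclotomic_mulchar fm (cyclotomicN (cyclotomic_nat C 1)) fP.
have gc := cyclotomic_gauss_sum psic fc.
have sum_f : \sum_x f x = 0.
  by apply: (mulchar_sum fm _ u0); rewrite fu eq_sym -addr_eq0 -(natrD _ 1 1) pnatr_eq0.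
have gg := gauss_sumV psia fm fm f2 sum_f.
have -> : p%:R = f (-1) * gauss_sum psi f ^+ 2.
  by rewrite expr2 gg card_Fp // mulrA f2 oppr_eq0 oner_eq0 mul1r.
apply: cyclotomic_squareM; last exact: cyclotomic_squareX2.
have [|i ->] := fP (-1); first by rewrite oppr_eq0 oner_eq0.
by apply: (@cyclotomic_square_unity _ _ 2); rewrite // sqrr_sign.
Qed.

Lemma cyclotomic_square_nat n : cyclotomic_square (n%:R : C).
Proof.
elim/ltn_ind: n => n IH; have [n_gt1|] := ltnP 1 n; last first.
  case: n {IH} => [|[|//]] _; [exists 0 | exists 1].
  - exact: (cyclotomic_nat C 0).
  - by rewrite expr0n.
  - exact: (cyclotomic_nat C 1).
  - by rewrite expr1n.
rewrite -(divnK (pdiv_dvd n)) natrM; apply: cyclotomic_squareM.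
  by apply: IH; rewrite ltn_Pdiv ?prime_gt1 ?pdiv_prime // ltnW.
by apply: cyclotomic_square_prime; rewrite pdiv_prime.
Qed.

Lemma cyclotomic_square_int (m : int) : cyclotomic_square (m%:~R : C).
Proof.
case: m => m; first exact: cyclotomic_square_nat.
by rewrite NegzE rmorphN; apply/cyclotomic_squareN/cyclotomic_square_nat.
Qed.

Lemma cyclotomic_square_rat (r : rat) : cyclotomic_square (ratr r : C).
Proof.
have d0 : (denq r)%:~R != 0 :> C by rewrite intr_eq0 denq_neq0.
have -> : (ratr r : C) = (numq r * denq r)%:~R * ((denq r)%:~R^-1) ^+ 2.
  by rewrite /ratr intrM; field.
apply: cyclotomic_squareM (cyclotomic_square_int _) _.
by apply/cyclotomic_squareX2/cyclotomicV/cyclotomic_int.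
Qed.

End QuadraticGaussSum.

(** * Square roots attached to Gaussian integers *)

Section GaussianSquareRoots.
Variable C : numClosedFieldType.
Implicit Types a b c d s t : int.

Definition gaussian a b : C := a%:~R + 'i * b%:~R.

(* [w] stands for the modulus of [a + 'i b]; its sign is irrelevant. *)
Definition gaussian_root a b : Prop :=
  exists w : C, [/\ w ^+ 2 = (a ^+ 2 + b ^+ 2)%:~R, is_cyclotomic w
    & cyclotomic_square (gaussian a b * w)].

Lemma gaussianM a b c d :
  gaussian a b * gaussian c d = gaussian (a * c - b * d) (a * d + b * c).
Proof.
rewrite /gaussian !(intrD, intrM, rmorphN) /=.
transitivity (a%:~R * c%:~R + 'i ^+ 2 * b%:~R * d%:~R
  + 'i * (a%:~R * d%:~R + b%:~R * c%:~R) : C); first by ring.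
by rewrite sqrCi; ring.
Qed.

Lemma gaussian_rootM a b c d : gaussian_root a b -> gaussian_root c d ->
  gaussian_root (a * c - b * d) (a * d + b * c).
Proof.
move=> [w [w2 wc sw]] [v [v2 vc sv]]; exists (w * v); split.
- by rewrite exprMn w2 v2 -intrM; congr (_%:~R); ring.
- exact: cyclotomicM.
by rewrite -gaussianM mulrACA; apply: cyclotomic_squareM.
Qed.

(** For u = a + 'i b with conjugate v, [z ^+ 2] is u w and u v is [w ^+ 2], so v w is the square of
    [w ^+ 2 / z]. *)
Lemma gaussian_root_conj a b : gaussian_root a b -> gaussian_root a (- b).
Proof.
move=> [w [w2 wc [z zc z2]]]; exists w; split=> //; first by rewrite w2 sqrrN.
have uu : gaussian a b * gaussian a (- b) = w ^+ 2.
  by rewrite gaussianM w2 /gaussian; 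
    have -> : a * - b + b * a = 0 :> int by [ring];
    rewrite mulr0 addr0; congr (_%:~R); ring.
have [w0|w0] := eqVneq w 0.
  by rewrite w0 mulr0; exists 0; [exact: (cyclotomic_nat C 0) | rewrite expr0n].
have u0 : gaussian a b != 0.
  by apply: contra_neq w0 => u0; apply/eqP; rewrite -sqrf_eq0 -uu u0 mul0r.
exists (w ^+ 2 / z).
  by apply: cyclotomic_div => //; apply: cyclotomicX.
rewrite expr_div_n z2 [_ ^+ 2 ^+ 2]expr2 -{1}uu; field.
by rewrite w0 u0.
Qed.

Lemma gaussian_root_nat (n : nat) : gaussian_root n%:Z 0.
Proof.
exists n%:R; split; first by rewrite expr0n addr0 rmorphXn /= -pmulrn.
  exact: cyclotomic_nat.
rewrite /gaussian mulr0 addr0 -pmulrn -expr2.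
exact/cyclotomic_squareX2/cyclotomic_nat.
Qed.

(** These are the units of Z['i], which are fourth roots of unity. *)
Lemma gaussian_root_unit a b : a ^+ 2 + b ^+ 2 = 1 -> gaussian_root a b.
Proof.
move=> ab; exists 1; rewrite ab expr1n; split=> //.
  exact: (cyclotomic_nat C 1).
rewrite mulr1; apply: (@cyclotomic_square_unity _ _ 4) => //.
have [a0|b0] : a = 0 \/ b = 0 by nia.
  have b2 : b ^+ 2 = 1 by rewrite -ab a0; ring.
  rewrite /gaussian a0 add0r exprMn (exprM _ 2 2) sqrCi sqrrN expr1n mul1r.
  by rewrite -rmorphXn (exprM _ 2 2) b2.
have a2 : a ^+ 2 = 1 by rewrite -ab b0; ring.
by rewrite /gaussian b0 mulr0 addr0 -rmorphXn /= (exprM _ 2 2) a2.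
Qed.

(** The Gaussian prime above 2: divided by [w], a square root of 2, it is an eighth root of
    unity. *)
Lemma gaussian_root_1i : gaussian_root 1 1.
Proof.
have [w wc w2] := cyclotomic_sqrt2 C; exists w; split=> //.
have u2 : gaussian 1 1 ^+ 2 = 'i * w ^+ 2.
  rewrite expr2 gaussianM w2 /gaussian; ring.
have w0 : w != 0 by rewrite -sqrf_eq0 w2 pnatr_eq0.
have -> : gaussian 1 1 * w = (gaussian 1 1 / w) * w ^+ 2 by field.
apply: cyclotomic_squareM (cyclotomic_squareX2 wc).
apply: (@cyclotomic_square_unity _ _ 8) => //.
rewrite (exprM _ 2 4) expr_div_n u2 mulfK ?sqrf_eq0 //.
by rewrite (exprM _ 2 2) sqrCi sqrrN expr1n.
Qed.

End GaussianSquareRoots.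

(** * Gaussian primes and factorization by descent on the norm *)

Section GaussianPrimes.
Variable C : numClosedFieldType.
Implicit Types a b c d s t : int.

Lemma gaussian_sum (I : Type) (r : seq I) (F : I -> C) :
  (forall i, exists a b, F i = gaussian C a b) ->
  exists a b, \sum_(i <- r) F i = gaussian C a b.
Proof.
move=> gF; elim: r => [|i r [a [b e]]].
  by exists 0, 0; rewrite big_nil /gaussian mulr0 addr0.
have [c [d f]] := gF i; exists (c + a), (d + b).
by rewrite big_cons e f /gaussian !intrD; ring.
Qed.

(** The character [f] takes the value ['i] at a generator, so its Jacobi sum lies in Z['i]. This sum
    is the Gaussian integer sought, and the quadratic Gauss sum [g2] serves as its modulus. *)
Lemma gaussian_prime p : prime p -> (p %% 4 = 1)%N ->
  exists s t, s ^+ 2 + t ^+ 2 = p%:Z /\ gaussian_root C s t.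
Proof.
move=> p_pr p1; have [psi [psia psic]] := addchar_exists C p_pr.
have i4 : 'i ^+ 4 = 1 :> C by rewrite (exprM _ 2 2) sqrCi sqrrN expr1n.
have iN : ('i : C) ^+ #|'F_p|.-1 = 1.
  rewrite card_Fp // (divn_eq p 4) p1 addn1 /= mulnC exprM i4 expr1n //.
have [f [u [fm u0 fu fP]]] := mulchar_exists iN.
have f4 x : x != 0 -> f x ^+ 4 = 1.
  by move=> /fP[i ->]; rewrite -exprM mulnC exprM i4 expr1n.
have f2m := is_mulcharX (ltn0Sn 1) fm; have f3m := is_mulcharX (ltn0Sn 2) fm.
have n11 : -1 != 1 :> C by rewrite eq_sym -addr_eq0 -(natrD _ 1 1) pnatr_eq0.
have sum_f : \sum_x f x = 0.
  apply: (mulchar_sum fm _ u0); rewrite fu; apply: contra_neq n11 => i1.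
  by rewrite -sqrCi i1 expr1n.
have sum_f2 : \sum_x f x ^+ 2 = 0.
  by apply: (mulchar_sum f2m _ u0); rewrite fu sqrCi.
have f6 x : f x ^+ 3 * f x ^+ 3 = f x ^+ 2.
  rewrite -exprD; have [->|/f4 x4] := eqVneq x 0.
    by rewrite (mulchar0 fm) !expr0n.
  by rewrite (exprD _ 4 2) x4 mul1r.
have sum_ff : \sum_x f x * f x = 0 by under eq_bigr do rewrite -expr2.
have sum_f3 : \sum_x f x ^+ 3 * f x ^+ 3 = 0 by under eq_bigr do rewrite f6.
have f22 x : f x ^+ 2 * f x ^+ 2 = (x != 0)%:R.
  rewrite -exprD; have [->|/f4//] := eqVneq x 0.
  by rewrite (mulchar0 fm) !expr0n.
have f13 x : f x * f x ^+ 3 = (x != 0)%:R by rewrite -exprS (exprD _ 2 2) f22.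
pose g2 := gauss_sum psi (fun x => f x ^+ 2).
have E1 := gauss_sumM psia fm fm sum_ff.
have E3 := gauss_sumM psia f3m f3m sum_f3.
have E13 := gauss_sumV psia fm f3m f13 sum_f.
have E22 := gauss_sumV psia f2m f2m f22 sum_f2.
rewrite card_Fp // in E13 E22.
have fN1 : f (-1) ^+ 2 = 1.
  by rewrite expr2 -(mulcharM fm) mulrNN mulr1 (mulchar1 fm).
rewrite fN1 mul1r in E22.
have eq_gauss (h k : 'F_p -> C) : h =1 k -> gauss_sum psi h = gauss_sum psi k.
  by move=> hk; apply: eq_bigr => x _; rewrite hk.
rewrite (eq_gauss _ (fun x => f x ^+ 2) (fun x => esym (expr2 (f x)))) in E1.
rewrite (eq_gauss _ _ f6) in E3.
have p0 : (p%:R : C) != 0 by rewrite pnatr_eq0 -lt0n prime_gt0.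
(* Multiplied by [g2 ^+ 2], which is [p], the left side becomes the square of the product of the
   Gauss sums of [f] and of its cube, that is, of [f (-1) * p]. *)
have JJ : jacobi_sum f f * jacobi_sum (fun x => f x ^+ 3) (fun x => f x ^+ 3)
    = p%:R.
  apply: (mulIf p0); rewrite -{1}E22 mulrACA -E1 -E3 mulrACA E13.
  by rewrite mulrACA -[f _ * f _]expr2 fN1 mul1r.
(* The values are 0 and fourth roots of unity, on which conjugation is cubing; so the second Jacobi
   sum is the conjugate of the first. *)
have conj_f x : (f x)^* = f x ^+ 3.
  have [->|/fP[i ->]] := eqVneq x 0; first by rewrite (mulchar0 fm) conjC0 expr0n.
  rewrite rmorphXn /= conjCi -exprM mulnC exprM; congr (_ ^+ _).
  by rewrite exprS sqrCi mulrN1.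
have gauss_f x : exists a b, f x = gaussian C a b.
  have [->|/fP[i ->]] := eqVneq x 0.
    by exists 0, 0; rewrite (mulchar0 fm) /gaussian mulr0 addr0.
  elim: i => [|i [a [b e]]]; first by exists 1, 0; rewrite /gaussian mulr0 addr0.
  exists (- b), a; rewrite exprS e /gaussian mulrDr mulrA -expr2 sqrCi rmorphN /=.
  by ring.
have [s [t J]] : exists s t, jacobi_sum f f = gaussian C s t.
  apply: gaussian_sum => x; have [a [b ->]] := gauss_f x.
  have [c [d ->]] := gauss_f (1 - x); rewrite gaussianM.
  by exists (a * c - b * d), (a * d + b * c).
have st : s ^+ 2 + t ^+ 2 = p%:Z.
  apply: (@intr_inj C); rewrite -pmulrn -JJ J.
  have -> : jacobi_sum (fun x => f x ^+ 3) (fun x => f x ^+ 3)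
      = (gaussian C s t)^*.
    rewrite -J.
    rewrite /jacobi_sum rmorph_sum; apply: eq_bigr => x _.
    by rewrite rmorphM /= !conj_f.
  have -> : (gaussian C s t)^* = s%:~R - 'i * t%:~R.
    by rewrite /gaussian rmorphD rmorphM /= conjCi !conj_Creal ?realz // mulNr.
  rewrite intrD !rmorphXn /= /gaussian.
  transitivity (s%:~R ^+ 2 - 'i ^+ 2 * t%:~R ^+ 2 : C); last by ring.
  by rewrite sqrCi; ring.
exists s, t; split=> //; exists g2.
have fc := cyclotomic_mulchar fm (cyclotomic_i C) fP.
have gc := cyclotomic_gauss_sum psic fc.
split; first by rewrite st expr2 E22 pmulrn.
  by apply: cyclotomic_gauss_sum => // x; apply: cyclotomicX.
by rewrite -J -E1 -expr2; apply: cyclotomic_squareX2.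
Qed.

Lemma prime_dvdzM p a b : prime p -> (p %| a * b)%Z = (p %| a)%Z || (p %| b)%Z.
Proof.
by move=> p_pr; rewrite !(dvdz_pcharf (pchar_Fp p_pr)) intrM mulf_eq0.
Qed.

(** Modulo such a [p], -1 is not a square. If [a] and [b] were both nonzero, raising
    [a ^+ 2 = - b ^+ 2] to the odd power (p - 1) / 2 would give 1 = -1. *)
Lemma dvdz_sum_squares3 p a b : prime p -> (p %% 4 = 3)%N ->
  (p %| a ^+ 2 + b ^+ 2)%Z -> (p %| a)%Z.
Proof.
move=> p_pr p3; have pF := pchar_Fp p_pr; rewrite !(dvdz_pcharf pF).
rewrite intrD !rmorphXn /= => ab; apply: contraTT ab => a0.
have [/eqP b0|b0] := boolP ((b%:~R : 'F_p) == 0).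
  by rewrite b0 expr0n addr0 sqrf_eq0.
have cardp x : x != 0 :> 'F_p -> x ^+ p.-1 = 1.
  move=> x0; apply: (mulfI x0); rewrite -exprS prednK ?prime_gt0 //.
  by have := expf_card x; rewrite card_Fp // mulr1.
rewrite addr_eq0; apply/negP => /eqP e.
(* For p = 4 q + 3 this exponent 2 q + 1 is (p - 1) / 2. *)
have := congr1 (fun x => x ^+ (p %/ 4).*2.+1) e.
have p1 : (2 * (p %/ 4).*2.+1 = p.-1)%N by lia.
rewrite exprNn -!exprM p1 !cardp // mulr1 -signr_odd /= odd_double /= expr1.
move=> /eqP; rewrite -addr_eq0 -(natrD _ 1 1) -(dvdn_pcharf pF).
by move=> /dvdn_leq; lia.
Qed.

(** Division by s + 'i t in Z['i]: [s * a + t * b] and [s * b - t * a] are the real and imaginary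
    parts of (a + 'i b)(s - 'i t). Their squares add up to a multiple of [p], so divisibility of one
    part gives that of the other. *)
Lemma gaussian_dvd p s t a b : prime p -> s ^+ 2 + t ^+ 2 = p%:Z ->
  (p %| a ^+ 2 + b ^+ 2)%Z -> (p %| s * b - t * a)%Z ->
  exists c d, a = s * c - t * d /\ b = s * d + t * c.
Proof.
move=> p_pr st pab pd.
have p0 : p%:Z != 0 by rewrite eqz_nat -lt0n prime_gt0.
have pc : (p %| s * a + t * b)%Z.
  have : (p %| (s * a + t * b) ^+ 2)%Z.
    have -> : (s * a + t * b) ^+ 2
      = (s ^+ 2 + t ^+ 2) * (a ^+ 2 + b ^+ 2) - (s * b - t * a) * (s * b - t * a).
      by ring.
    by rewrite st rpredB ?dvdz_mulr // dvdz_mull.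
  by rewrite expr2 prime_dvdzM // orbb.
have /dvdzP[c cE] := pc; have /dvdzP[d dE] := pd.
exists c, d; split; apply: (mulfI p0).
  transitivity (s * (c * p) - t * (d * p)); last by ring.
  by rewrite -cE -dE -st; ring.
transitivity (s * (d * p) + t * (c * p)); last by ring.
by rewrite -cE -dE -st; ring.
Qed.

(** Induction on the norm [N]: a Gaussian prime above the least prime divisor [p] of [N] is split
    off. It is 1 + 'i for p = 2, a factor of norm [p] for p = 1 mod 4, and [p] itself for p = 3 mod
    4. *)
Lemma gaussian_root_all a b : gaussian_root C a b.
Proof.
have [n] := ubnP (absz (a ^+ 2 + b ^+ 2)); elim: n a b => // n IH a b.
rewrite ltnS => abn; set N := (a ^+ 2 + b ^+ 2) in abn.
have N0 : 0 <= N by rewrite addr_ge0 ?sqr_ge0.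
have [N_0|N_gt0] := eqVneq N 0.
  have [-> ->] : a = 0 /\ b = 0 by rewrite /N in N_0; nia.
  exact: (gaussian_root_nat C 0).
have [N1|N_neq1] := eqVneq N 1; first exact: gaussian_root_unit.
pose p := pdiv (absz N); have p_pr : prime p by apply: pdiv_prime; lia.
have pN : (p %| N)%Z by rewrite dvdzE pdiv_dvd.
have p_gt1 := prime_gt1 p_pr.
(* A factor of norm greater than 1 leaves a cofactor of smaller norm, to which the induction
   hypothesis applies. *)
have split_root s t c d : gaussian_root C s t -> (1 < s ^+ 2 + t ^+ 2) ->
    a = s * c - t * d -> b = s * d + t * c -> gaussian_root C a b.
  move=> st st1 ac bd; rewrite ac bd; apply: gaussian_rootM => //; apply: IH.
  have NE : N = (s ^+ 2 + t ^+ 2) * (c ^+ 2 + d ^+ 2) by rewrite /N ac bd; ring.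
  have cd0 : 0 <= c ^+ 2 + d ^+ 2 by rewrite addr_ge0 ?sqr_ge0.
  have cd_gt0 : 0 < c ^+ 2 + d ^+ 2.
    by rewrite lt_def cd0 andbT; apply: contraNneq N_gt0 => cd; rewrite NE cd mulr0.
  have : c ^+ 2 + d ^+ 2 < N by rewrite NE ltr_pMl.
  move: abn cd0; clear; move: (c ^+ 2 + d ^+ 2) => X; lia.
have : (p = 2 \/ p %% 4 = 1 \/ p %% 4 = 3)%N.
  by have [->|] := even_prime p_pr; [left | lia].
move=> [p2|[p1|p3]].
- have /dvdzP[c cE] : (p %| a + b)%Z.
    have : (p %| (a + b) ^+ 2)%Z.
      have -> : (a + b) ^+ 2 = N + a * b * p by rewrite p2 /N; ring.
      by rewrite rpredD ?dvdz_mull.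
    by rewrite expr2 prime_dvdzM // orbb.
  rewrite p2 in cE; have aE : a = c * 2 - b by rewrite -cE addrK.
  apply: (split_root 1 1 c (b - c) (gaussian_root_1i C)) => //; first by rewrite aE; ring.
  by ring.
- have [s [t [st gst]]] := gaussian_prime p_pr p1.
  (* The two factors decide divisibility by s + 'i t and by its conjugate; [p] divides their
     product, hence one of them. *)
  have : (p %| (s * b - t * a) * (s * b - - t * a))%Z.
    have -> : (s * b - t * a) * (s * b - - t * a)
      = s ^+ 2 * N - a ^+ 2 * (s ^+ 2 + t ^+ 2) by rewrite /N; ring.
    by rewrite st rpredB ?dvdz_mull.
  rewrite prime_dvdzM // => /orP[pd|pd].
    have [c [d [ac bd]]] := gaussian_dvd p_pr st pN pd.
    by apply: split_root gst _ ac bd; rewrite st ltz_nat.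
  have st' : s ^+ 2 + (- t) ^+ 2 = p%:Z by rewrite sqrrN.
  have [c [d [ac bd]]] := gaussian_dvd p_pr st' pN pd.
  by apply: split_root (gaussian_root_conj gst) _ ac bd; rewrite st' ltz_nat.
have pa := dvdz_sum_squares3 p_pr p3 pN.
have pb : (p %| b)%Z.
  by apply: (dvdz_sum_squares3 p_pr p3 (b := a)); rewrite addrC.
have /dvdzP[c ac] := pa; have /dvdzP[d bd] := pb.
apply: (split_root p%:Z 0 c d (gaussian_root_nat C p)).
- by rewrite expr0n addr0 expr_gt1.
- by rewrite ac; ring.
- by rewrite bd; ring.
Qed.

(** Multiplying by the common denominator [d] reduces to Gaussian integers, with [w * d] as the
    modulus up to sign. *)
Lemma cyclotomic_gaussian_sqrt (u v : rat) (w r : C) :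
  w ^+ 2 = ratr (u ^+ 2 + v ^+ 2) -> r ^+ 2 = (ratr u + 'i * ratr v) * w ->
  is_cyclotomic r.
Proof.
move=> w2 r2; pose d := denq u * denq v.
have du0 := denq_neq0 u; have dv0 := denq_neq0 v.
have d0 : d%:~R != 0 :> C by rewrite intr_eq0 mulf_neq0.
pose a := numq u * denq v; pose b := numq v * denq u.
have uE : ratr u * d%:~R = a%:~R :> C.
  by rewrite /ratr /d /a !intrM; field; rewrite intr_eq0.
have vE : ratr v * d%:~R = b%:~R :> C.
  by rewrite /ratr /d /b !intrM; field; rewrite intr_eq0.
have [W [W2 _ sW]] := gaussian_root_all a b.
have wW : W = w * d%:~R \/ W = - (w * d%:~R).
  have /eqP : W ^+ 2 = (w * d%:~R) ^+ 2.
    rewrite W2 [(w * _) ^+ 2]exprMn w2 intrD !rmorphXn /= -uE -vE rmorphD !rmorphXn /=; ring.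
  by rewrite eqf_sqr => /orP[]/eqP; [left | right].
have cdr : cyclotomic_square ((r * d%:~R) ^+ 2).
  have -> : (r * d%:~R) ^+ 2 = gaussian C a b * (w * d%:~R).
    by rewrite exprMn r2 /gaussian -uE -vE; ring.
  case: wW sW => -> //; rewrite mulrN => /cyclotomic_squareN.
  by rewrite opprK.
have -> : r = r * d%:~R / d%:~R by rewrite mulfK.
apply: cyclotomic_div; last exact: cyclotomic_int.
exact: cyclotomic_sqrt cdr erefl.
Qed.

End GaussianPrimes.
(** * Quadratic and quartic irrationalities *)

Section QuarticEigenvalues.
Variable C : numClosedFieldType.
Implicit Types u v w x y : C.

Lemma cyclotomic_half_sum u v :
  is_cyclotomic (u + v) -> is_cyclotomic (u - v) ->
  is_cyclotomic u /\ is_cyclotomic v.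
Proof.
move=> cD cB; have c2 := cyclotomic_nat C 2.
split; [have -> : u = (u + v + (u - v)) / 2 by field
       | have -> : v = (u + v - (u - v)) / 2 by field].
  exact: cyclotomic_div (cyclotomicD cD cB) c2.
exact: cyclotomic_div (cyclotomicB cD cB) c2.
Qed.

(** The square of [u - v] is the rational number [2 * q - p ^+ 2]. *)
Lemma cyclotomic_quadratic u v (p q : rat) :
  u + v = ratr p -> u ^+ 2 + v ^+ 2 = ratr q -> is_cyclotomic u.
Proof.
move=> uvp uvq; suff [] : is_cyclotomic u /\ is_cyclotomic v by [].
apply: cyclotomic_half_sum; first by rewrite uvp; apply: cyclotomic_rat.
apply: cyclotomic_sqrt (cyclotomic_square_rat C (2 * q - p ^+ 2)) _.
by rewrite rmorphB rmorphM rmorphXn /= -uvp -uvq rmorph_nat; ring.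
Qed.

(** The rationals [s] and [t] are chosen so that [s * w = - (x ^+ 2 - y ^+ 2)] and
    [s ^+ 2 + t ^+ 2 = n]. With [r] and [r'] square roots of (s + 'i t) w and (s - 'i t) w, 2 x
    equals 'i (r + r') up to sign and 2 y equals r - r' up to sign. *)
Lemma cyclotomic_cyclic_quartic n w x y (p q : rat) : (0 < n)%N ->
  w ^+ 2 = n%:R -> x ^+ 2 + y ^+ 2 = - n%:R -> (x ^+ 2 - y ^+ 2) * w = ratr p ->
  2 * x * y * w = ratr q -> is_cyclotomic x /\ is_cyclotomic y.
Proof.
move=> n0 w2 xy xyp xyq; set N : C := n%:R in w2 xy.
have N0 : N != 0 by rewrite pnatr_eq0 -lt0n.
have w0 : w != 0 by rewrite -sqrf_eq0 w2.
pose s : rat := - p / n%:R; pose t : rat := q / n%:R.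
have sE : ratr s = - ((x ^+ 2 - y ^+ 2) * w) / N :> C.
  by rewrite /s rmorphM fmorphV rmorphN /= rmorph_nat xyp.
have tE : ratr t = 2 * x * y * w / N :> C.
  by rewrite /t rmorphM fmorphV /= rmorph_nat xyq.
have swE : ratr s * w = - (x ^+ 2 - y ^+ 2).
  by rewrite sE -w2; field.
have w2E : w ^+ 2 = ratr (s ^+ 2 + t ^+ 2).
  rewrite rmorphD !rmorphXn /= sE tE.
  transitivity (w ^+ 2 * (x ^+ 2 + y ^+ 2) ^+ 2 / N ^+ 2); last by field.
  by rewrite xy sqrrN mulfK ?expf_neq0.
pose r : C := sqrtC ((ratr s + 'i * ratr t) * w).
have r2 : r ^+ 2 = (ratr s + 'i * ratr t) * w by rewrite sqrtCK.
have cr : is_cyclotomic r by apply: cyclotomic_gaussian_sqrt w2E r2.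
have rr : r ^+ 2 * ((ratr s - 'i * ratr t) * w) = N ^+ 2.
  transitivity ((ratr s ^+ 2 - 'i ^+ 2 * ratr t ^+ 2) * w ^+ 2 : C).
    by rewrite r2; ring.
  have st : ratr s ^+ 2 + ratr t ^+ 2 = N.
    by rewrite -w2 w2E rmorphD !rmorphXn.
  by rewrite sqrCi mulN1r opprK st w2 -expr2.
have r0 : r != 0.
  by apply: contra_neq N0 => r0; apply/eqP; rewrite -sqrf_eq0 -rr r0 expr0n mul0r.
(* Taking [r'] as a quotient rather than as a second [sqrtC] fixes its sign, so that
   [r * r' = N]. *)
pose r' := N / r.
have cr' : is_cyclotomic r' by apply: cyclotomic_div cr; apply: cyclotomic_nat.
have r'2 : r' ^+ 2 = (ratr s - 'i * ratr t) * w.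
  by apply: (mulfI (expf_neq0 2 r0)); rewrite rr /r' exprMn exprVn; field.
have rr' : r * r' = N by rewrite /r'; field.
have c2 := cyclotomic_nat C 2.
have half (z : C) : is_cyclotomic (2 * z) -> is_cyclotomic z.
  move=> cz; have -> : z = 2 * z / 2 by field.
  exact: cyclotomic_div cz c2.
split; apply: half.
  apply: (@cyclotomic_sqrt _ (('i * (r + r')) ^+ 2)).
    apply: cyclotomic_squareX2; apply: cyclotomicM (cyclotomic_i C) _.
    exact: cyclotomicD.
  transitivity (- (r ^+ 2 + r' ^+ 2 + 2 * (r * r'))); last first.
    by rewrite [('i * _) ^+ 2]exprMn sqrCi; ring.
  transitivity (- (2 * (ratr s * w) + 2 * N)); last by rewrite r2 r'2 rr'; ring.
  rewrite swE; transitivity (2 * (x ^+ 2 - y ^+ 2) + 2 * (- N)); last by ring.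
  by rewrite -xy; ring.
apply: (@cyclotomic_sqrt _ ((r - r') ^+ 2)).
  exact/cyclotomic_squareX2/cyclotomicB.
transitivity (r ^+ 2 + r' ^+ 2 - 2 * (r * r')); last by ring.
transitivity (2 * (ratr s * w) + 2 * (- N)); last by rewrite r2 r'2 rr'; ring.
by rewrite swE -xy; ring.
Qed.

(* The case [c = b], [c' = b'] of [quartic_eigenvalues]. *)
Lemma quartic_core (k : nat) (a a' b b' d d' : C) (p q : rat) :
  a + a' + b + b' = -1 -> (b + b') + (d + d') = -1 ->
  2 * (a * a' + b * b') = (3 * k + 1)%:R -> b * b' + d * d' = a * a' + b * b' ->
  a * b' + a' * b + b * d' + b' * d = - k%:R ->
  a * b + a' * b' + b * d + b' * d' = - k%:R ->
  (a - a') ^+ 2 * (a + a' - b - b')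
    + (b - b') ^+ 2 * (b + b' - d - d') = ratr p ->
  (a - a') * (b - b') * (a + a' - b - b')
    + (b - b') * (d - d') * (b + b' - d - d') = ratr q ->
  [/\ is_cyclotomic a, is_cyclotomic a', is_cyclotomic b & is_cyclotomic b'].
Proof.
move=> s1 s2 n1 n2 o1 o2 r1 r2.
have dd : d + d' = a + a' by apply: (addrI (b + b')); rewrite s2 -s1; ring.
have prod_d : d * d' = a * a' by apply: (addrI (b * b')); rewrite n2 addrC.
(* This is half the sum of [o1] and [o2], because [d + d' = a + a']. *)
have st : (a + a') * (b + b') = - k%:R.
  have : 2 * ((a + a') * (b + b')) = 2 * (- k%:R).
    transitivity ((a + a') * (b + b') + (d + d') * (b + b')).
      by rewrite dd; ring.
    transitivity (- k%:R + - k%:R : C); last by ring.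
    by rewrite -{1}o1 -o2; ring.
  by apply: mulfI; rewrite pnatr_eq0.
pose w := a + a' - b - b'.
have bE : b + b' = -1 - (a + a') by rewrite -s1; ring.
have w2 : w ^+ 2 = (4 * k + 1)%:R.
  transitivity ((a + a' + b + b') ^+ 2 - 4 * ((a + a') * (b + b'))).
    by rewrite /w; ring.
  by rewrite s1 st natrD natrM; ring.
have cw : is_cyclotomic w by apply: cyclotomic_sqrt (cyclotomic_square_nat _ _) w2.
have c1 := cyclotomic_nat C 1; have c2 := cyclotomic_nat C 2.
have ca : is_cyclotomic (a + a').
  have -> : a + a' = (w - 1) / 2 by rewrite -[- 1]s1 /w; field.
  by apply: cyclotomic_div => //; apply: cyclotomicB.
have cb : is_cyclotomic (b + b').
  by rewrite bE; apply: cyclotomicB => //; apply: cyclotomicN.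
have xy : (a - a') ^+ 2 + (b - b') ^+ 2 = - (4 * k + 1)%:R.
  transitivity ((a + a' + b + b') ^+ 2 - 2 * ((a + a') * (b + b'))
    - 2 * (2 * (a * a' + b * b'))); first by ring.
  by rewrite s1 st n1 !(natrD _ (_ * _)) !natrM; ring.
suff [cx cy] : is_cyclotomic (a - a') /\ is_cyclotomic (b - b').
  have [? ?] := cyclotomic_half_sum ca cx.
  by have [? ?] := cyclotomic_half_sum cb cy.
(* The pairs [d, d'] and [a, a'] have the same sum and product, so they agree up to order. The two
   orders are the two character tables. *)
have /eqP : (d - a) * (d - a') = 0.
  transitivity (d ^+ 2 - d * (a + a') + a * a'); first by ring.
  by rewrite -dd -prod_d; ring.
rewrite mulf_eq0 !subr_eq0 => /orP[]/eqP dE.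
  have d'E : d' = a' by apply: (addrI a); rewrite -dd dE.
  (* For [d = a], the difference of the two orthogonality relations is twice this product. One
     difference is then 0, and by [xy] the other squares to -(4 k + 1). *)
  have /eqP : (a - a') * (b - b') = 0.
    have : 2 * ((a - a') * (b - b')) = 0.
      transitivity ((a * b + a' * b' + b * d + b' * d')
        - (a * b' + a' * b + b * d' + b' * d)).
        by rewrite dE d'E; ring.
      by rewrite o1 o2 subrr.
    by move/eqP; rewrite mulf_eq0 pnatr_eq0 /= => /eqP.
  have cn : cyclotomic_square (- (4 * k + 1)%:R : C).
    exact/cyclotomic_squareN/cyclotomic_square_nat.
  have c0 := cyclotomic_nat C 0.
  rewrite mulf_eq0 => /orP[]/eqP z; rewrite z expr0n ?add0r ?addr0 in xy *.
    by split=> //; apply: cyclotomic_sqrt cn xy.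
  by split=> //; apply: cyclotomic_sqrt cn xy.
have d'E : d' = a by apply: (addrI a'); rewrite -{1}dE dd addrC.
(* For [d = a'] the second pair has [- w] in place of [w], which turns [r1] and [r2] into the two
   rationality hypotheses on [a - a'] and [b - b']. *)
apply: (@cyclotomic_cyclic_quartic (4 * k + 1) w _ _ p q) => //.
- by rewrite addn1.
- by rewrite -r1 dE d'E /w; ring.
- by rewrite -r2 dE d'E /w; ring.
Qed.

(** The values of one character at [b1], [star b1], [b3], [star b3] are [a, a', b, b'], and those of
    a character of the other pair are [c, c', d, d']. The hypotheses are row and column
    orthogonality and two rational traces. Since [c, c'] have the sum and product of [b, b'], they
    agree with them up to order. *)
Lemma quartic_eigenvalues (k : nat) (a a' b b' c c' d d' : C) (p q : rat) :
  a + a' + b + b' = -1 -> a + a' + c + c' = -1 -> c + c' + d + d' = -1 ->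
  2 * (a * a' + b * b') = (3 * k + 1)%:R ->
  a * a' + c * c' = a * a' + b * b' -> c * c' + d * d' = a * a' + b * b' ->
  a * c' + a' * c + b * d' + b' * d = - k%:R ->
  a * c + a' * c' + b * d + b' * d' = - k%:R ->
  (a - a') ^+ 2 * (a + a' - b - b')
    + (c - c') ^+ 2 * (c + c' - d - d') = ratr p ->
  (a - a') * (b - b') * (a + a' - b - b')
    + (c - c') * (d - d') * (c + c' - d - d') = ratr q ->
  [/\ is_cyclotomic a, is_cyclotomic a', is_cyclotomic b & is_cyclotomic b'].
Proof.
move=> s1 s2 s3 n1 n2 n3 o1 o2 r1 r2.
have cc : c + c' = b + b'.
  by apply: (addrI (a + a')); rewrite !addrA s1 s2.
have prod_c : c * c' = b * b' by apply: (addrI (a * a')).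
have /eqP : (c - b) * (c - b') = 0.
  transitivity (c ^+ 2 - c * (b + b') + b * b'); first by ring.
  by rewrite -cc -prod_c; ring.
rewrite mulf_eq0 !subr_eq0 => /orP[]/eqP cE.
  have c'E : c' = b' by apply: (addrI b); rewrite -cc cE.
  rewrite cE c'E in s3 n3 o1 o2 r1 r2.
  by apply: quartic_core s1 _ n1 n3 o1 o2 r1 r2; rewrite addrA.
have c'E : c' = b by apply: (addrI b'); rewrite -{1}cE cc addrC.
(* If [c = b'], the second character is replaced by its conjugate, which exchanges [d] with [d'] and
   [o1] with [o2]. *)
apply: (@quartic_core k a a' b b' d' d p q) => //.
- by rewrite -s3 cE c'E; ring.
- by rewrite -n3 cE c'E; ring.
- by rewrite -o2 cE c'E; ring.
- by rewrite -o1 cE c'E; ring.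
- by rewrite -r1 cE c'E; ring.
- by rewrite -r2 cE c'E; ring.
Qed.

End QuarticEigenvalues.
(** * Characters of commutative table algebras *)

Section TableAlgebra.
Variables (C : numClosedFieldType) (A : falgType C) (star : A -> A) (r : nat).
Variables (B : r.+1.-tuple A) (delta : 'I_r.+1 -> C).
Hypotheses (hS : is_SITA star B delta) (hc : commutative (@GRing.mul A)).
Implicit Types (x y : A) (i j k : 'I_r.+1).

Local Notation b i := (tnth B i).
Local Notation co k := (coord B k).

Let hI := sita_ita hS.
Let hstar := ita_involution hI.

Lemma coord_expand x : x = \sum_i co i x *: b i.
Proof.
rewrite {1}(coord_basis (ita_basis hI) (memvf x)); apply: eq_bigr => i _.
by rewrite (tnth_nth 0).
Qed.

Lemma coord_tnth i j : co j (b i) = (i == j)%:R.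
Proof.
by rewrite (tnth_nth 0) coord_free //; apply: basis_free (ita_basis hI).
Qed.

Lemma tnth_basis_inj : injective (fun i => b i).
Proof.
move=> i j ij; have := coord_tnth i j; rewrite ij coord_tnth eqxx.
by case: eqVneq => // _ /eqP; rewrite oner_eq0.
Qed.

Lemma star_basis i : exists j, star (b i) = b j.
Proof. by have /tnthP := ita_star hI i. Qed.

Lemma star1 : star 1 = 1.
Proof. by have := starM hstar (star 1) 1; rewrite mulr1 (starK hstar) mulr1. Qed.

Lemma star0 : star 0 = 0.
Proof. by apply: (addrI (star 0)); rewrite -(starD hstar) !addr0. Qed.

Lemma star_sum (I : Type) (s : seq I) (F : I -> A) :
  star (\sum_(i <- s) F i) = \sum_(i <- s) star (F i).
Proof.
by elim: s => [|i s IH]; rewrite ?big_nil ?star0 // !big_cons (starD hstar) IH.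
Qed.

Lemma coord0_nat i j : exists n : nat, co ord0 (b i * b j) = n%:R.
Proof. exact: ita_integral hI i j ord0. Qed.

(** The basis is orthogonal for the form taking [x], [y] to the coefficient of 1 in [x * star y]: a
    nonzero coefficient is a positive integer, and the pseudo-inverse condition then forces
    [i = j]. *)
Lemma form_basis i j : co ord0 (b i * star (b j)) = (i == j)%:R * delta i.
Proof.
case: eqVneq => [<-|ij]; first by rewrite mul1r (sita_standard hS).
rewrite mul0r; have [k jk] := star_basis j.
have [n nE] := coord0_nat i k.
case: (posnP n) => [n0|n0]; first by rewrite jk nE n0.
have := (ita_pseudo_inverse hI i k).1; rewrite nE ltr0n => /(_ n0).
rewrite -jk => /(congr1 star); rewrite !(starK hstar) => /tnth_basis_inj ji.
by rewrite ji eqxx in ij.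
Qed.

Lemma degree_nat i : exists2 n : nat, (0 < n)%N & delta i = n%:R.
Proof.
have [k ik] := star_basis i; have [n nE] := coord0_nat i k.
exists n; last by rewrite -(sita_standard hS) ik.
by rewrite -(ltr0n C) -nE; apply/(ita_pseudo_inverse hI).
Qed.

Lemma degree_gt0 i : 0 < delta i.
Proof. by have [n n0 ->] := degree_nat i; rewrite ltr0n. Qed.

Lemma degree_neq0 i : delta i != 0.
Proof. by rewrite gt_eqF // degree_gt0. Qed.

Lemma coord_form k x : co k x = co ord0 (x * star (b k)) / delta k.
Proof.
rewrite {2}(coord_expand x) mulr_suml linear_sum /= (bigD1 k) //= big1 => [|i ik].
  by rewrite addr0 -scalerAl linearZ /= form_basis eqxx mul1r mulfK ?degree_neq0.
by rewrite -scalerAl linearZ /= form_basis (negPf ik) mul0r mulr0.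
Qed.

Lemma formE x y :
  co ord0 (x * star y) = \sum_k co k x * (co k y)^* * delta k.
Proof.
rewrite {1}(coord_expand y) star_sum mulr_sumr linear_sum /=; apply: eq_bigr => k _.
rewrite (starZ hstar) -scalerAr linearZ /= (coord_form k x).
by rewrite mulrAC divfK ?degree_neq0 // mulrC.
Qed.

Lemma form_eq0 x : co ord0 (x * star x) = 0 -> x = 0.
Proof.
rewrite formE => /eqP; rewrite psumr_eq0; last first.
  by move=> k _; rewrite mulr_ge0 ?mul_conjC_ge0 // ltW ?degree_gt0.
move=> /allP xk; rewrite (coord_expand x) big1 // => k _.
have := xk k (mem_index_enum _).
by rewrite mulf_eq0 (negPf (degree_neq0 k)) orbF mul_conjC_eq0 => /eqP->; rewrite scale0r.
Qed.

(** Positive definiteness of the form excludes nilpotents. If [y ^+ 2 = 0], the self-adjoint element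
    [y * star y] has square 0, hence vanishes, and then so does [y]. *)
Lemma reduced x n : x ^+ n = 0 -> x = 0.
Proof.
have red2 y : y ^+ 2 = 0 -> y = 0.
  move=> y2; apply: form_eq0; suff -> : y * star y = 0 by rewrite linear0.
  apply: form_eq0; rewrite (starM hstar) (starK hstar).
  by rewrite mulrA -[_ * _ * y]mulrA [star y * y]hc !mulrA -expr2 y2 !mul0r linear0.
elim/ltn_ind: n x => -[|[|n]] IH x.
- by rewrite expr0 => /eqP; rewrite oner_eq0.
- by rewrite expr1.
(* The power n + 1 of [x ^+ 2] vanishes, because 2 (n + 1) is at least n + 2. *)
move=> xn; apply: red2; apply: (IH n.+1) => //; rewrite -exprM mul2n.
by rewrite -addnn addSnnS exprD xn mulr0.
Qed.

(** * The regular representation and its simultaneous diagonalization *)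

Lemma regmxD x y : regmx B (x + y) = regmx B x + regmx B y.
Proof. by apply/matrixP => i j; rewrite !mxE mulrDl linearD. Qed.

Lemma regmxZ c x : regmx B (c *: x) = c *: regmx B x.
Proof. by apply/matrixP => i j; rewrite !mxE -scalerAl linearZ. Qed.

Lemma regmx0 : regmx B 0 = 0.
Proof. by apply/matrixP => i j; rewrite !mxE mul0r linear0. Qed.

Lemma regmx_sum x : regmx B x = \sum_i co i x *: regmx B (b i).
Proof.
apply/matrixP => i j; rewrite {1}(coord_expand x) !mxE summxE mulr_suml linear_sum.
by apply: eq_bigr => k _; rewrite !mxE -scalerAl linearZ.
Qed.

Lemma regmx1 : regmx B 1 = 1%:M.
Proof. by apply/matrixP => i j; rewrite !mxE mul1r coord_tnth eq_sym. Qed.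

Lemma regmxM x y : regmx B (x * y) = regmx B x *m regmx B y.
Proof.
apply/matrixP => i j; rewrite !mxE -mulrA {1}(coord_expand (y * _)) mulr_sumr.
rewrite linear_sum; apply: eq_bigr => k _ /=.
by rewrite !mxE -scalerAr linearZ mulrC.
Qed.

Lemma regmx_inj x y : regmx B x = regmx B y -> x = y.
Proof.
move=> xy; rewrite (coord_expand x) (coord_expand y); apply: eq_bigr => i _.
by have := congr1 (fun M : 'M_ _ => M i ord0) xy; rewrite !mxE (ita_one hI) !mulr1 => ->.
Qed.

(** Let [q] be the product of the distinct linear factors of the characteristic polynomial. By
    Cayley-Hamilton q(M) is nilpotent; it is the regular matrix of some [y], which vanishes by
    [reduced]. *)
Lemma regmx_diagonalizable x : diagonalizable (regmx B x).
Proof.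
set M := regmx B x; apply/diagonalizableP.
have [s sE] := closed_field_poly_normal (char_poly M).
rewrite (monicP (char_poly_monic M)) scale1r in sE.
exists (undup s); first exact: undup_uniq.
set q := \prod_(_ <- _) _; have [y yE] : exists y, horner_mx M q = regmx B y.
  elim/poly_ind: (q) => [|p c [y yE]].
    by exists 0; rewrite rmorph0 regmx0.
  exists (y * x + c *: 1); rewrite rmorphD rmorphM /= horner_mx_X horner_mx_C yE.
  by rewrite regmxD regmxM regmxZ regmx1 scalemx1.
suff y0 : y = 0.
  by apply: mxminpoly_min; rewrite yE y0 regmx0.
apply: (@reduced _ (size s)); apply: regmx_inj.
have regmxX n : regmx B (y ^+ n) = regmx B y ^+ n.
  by elim: n => [|n IH]; rewrite ?regmx1 // !exprS regmxM IH.
rewrite regmxX -yE -rmorphXn.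
have /dvdpP[p ->] : char_poly M %| q ^+ size s.
  have : {in s, forall z, 'X - z%:P %| q}.
    by move=> z zs; rewrite dvdp_XsubCl root_prod_XsubC mem_undup.
  rewrite sE; elim: (s) => [|z t IH] qz; first by rewrite big_nil dvd1p.
  rewrite big_cons exprS dvdp_mul ?qz ?mem_head // IH // => w wt.
  by rewrite qz // inE wt orbT.
by rewrite rmorphM /= Cayley_Hamilton mulr0 regmx0.
Qed.

(** The regular matrices commute and are diagonalizable, so one [P] diagonalizes them all; the
    characters are the diagonal entries. *)
Lemma characters_exist : exists chi : 'I_r.+1 -> A -> C,
  [/\ forall i, scalar (chi i), forall i, chi i 1 = 1,
      forall i, {morph chi i : x y / x * y},
      forall x, (forall i, chi i x = 0) -> x = 0 &
      forall x, \tr (regmx B x) = \sum_i chi i x /\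
        forall a, eigenvalue (regmx B x) a -> exists i, a = chi i x].
Proof.
have /codiagonalizableP[P Pu /allP PB] :
    {in [seq regmx B (b i) | i : 'I_r.+1] &, forall M N, comm_mx M N} /\
    {in [seq regmx B (b i) | i : 'I_r.+1], forall M, diagonalizable M}.
  split=> [M N /mapP[i _ ->] /mapP[j _ ->]|M /mapP[i _ ->]].
    by rewrite /comm_mx -!regmxM hc.
  exact: regmx_diagonalizable.
pose D x := P *m regmx B x *m invmx P.
have D_diag x i j : i != j -> D x i j = 0.
  move=> ij; rewrite /D regmx_sum mulmx_sumr mulmx_suml summxE big1 // => k _.
  rewrite -scalemxAr -scalemxAl mxE.
  have /PB/(diagonalizable_forP _ Pu)/(_ i j ij) -> : regmx B (b k) \in
    [seq regmx B (b i) | i : 'I_r.+1] by apply: map_f; rewrite mem_enum.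
  by rewrite mulr0.
have DM x y : D (x * y) = D x *m D y.
  by rewrite /D regmxM !mulmxA mulmxKV.
have DE x : regmx B x = invmx P *m D x *m P by rewrite /D !mulmxA mulVmx // mul1mx mulmxKV.
exists (fun i x => D x i i); split=> [i c x y|i|i x y|x x0|x].
- by rewrite /D regmxD regmxZ mulmxDr mulmxDl -scalemxAr -scalemxAl !mxE.
- by rewrite /D regmx1 mulmx1 mulmxV // mxE eqxx.
- rewrite DM mxE (bigD1 i) //= big1 ?addr0 // => k ki.
  by rewrite D_diag ?mul0r // eq_sym.
- apply: regmx_inj; rewrite DE; have -> : D x = 0.
    apply/matrixP => i j; rewrite [RHS]mxE; have [<-|] := eqVneq i j; [exact: x0 i | exact: D_diag].
  by rewrite mulmx0 mul0mx regmx0.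
split=> [|a].
  by rewrite DE mxtrace_mulC mulmxA mulmxV // mul1mx.
(* At a nonzero coordinate [i] of the eigenvector in the new basis, the eigenvalue is the diagonal
   entry [i]. *)
move=> /eigenvalueP[v va v0]; pose u := v *m invmx P.
have uP : u *m P = v by rewrite mulmxKV.
have u0 : u != 0 by apply: contraNneq v0 => u0; rewrite -uP u0 mul0mx.
have uD : u *m D x = a *: u.
  by rewrite /D !mulmxA uP va -scalemxAl.
have [i ui] : exists i, u ord0 i != 0.
  apply/existsP; apply: contraNT u0; rewrite negb_exists => /forallP ui.
  by apply/eqP/rowP => i; rewrite [RHS]mxE; apply/eqP/negPn.
exists i; have := congr1 (fun M : 'rV_ _ => M ord0 i) uD.
rewrite mxE [RHS]mxE (bigD1 i) //= big1.
  by rewrite addr0 mulrC => /(mulIf ui).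
by move=> j ji; rewrite D_diag // mulr0.
Qed.

(** * Primitive idempotents, classification of characters and orthogonality *)

Section Characters.
Variable chi : 'I_r.+1 -> A -> C.
Hypotheses (chi_lin : forall i, scalar (chi i)) (chi1 : forall i, chi i 1 = 1).
Hypothesis chiM : forall i, {morph chi i : x y / x * y}.
Hypothesis chi_inj : forall x, (forall i, chi i x = 0) -> x = 0.
Hypothesis chi_eigen : forall x a,
  eigenvalue (regmx B x) a -> exists i, a = chi i x.

Section ScalarMap.
Variable f : A -> C.
Hypothesis f_lin : scalar f.

Lemma functional0 : f 0 = 0.
Proof. have := f_lin (-1) 0 0; rewrite scaler0 addr0 mulN1r addNr; apply. Qed.

Lemma functionalZ c x : f (c *: x) = c * f x.
Proof. by have := f_lin c x 0; rewrite functional0 !addr0; apply. Qed.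

Lemma functionalD x y : f (x + y) = f x + f y.
Proof. by have := f_lin 1 x y; rewrite scale1r mul1r; apply. Qed.

Lemma functionalB x y : f (x - y) = f x - f y.
Proof. by rewrite -scaleN1r functionalD functionalZ mulN1r. Qed.

Lemma functional_sum (I : Type) (s : seq I) (F : I -> A) :
  f (\sum_(i <- s) F i) = \sum_(i <- s) f (F i).
Proof.
by elim: s => [|i s IH]; rewrite ?big_nil ?functional0 // !big_cons functionalD IH.
Qed.

Lemma functional_expand x : f x = \sum_k co k x * f (b k).
Proof.
by rewrite {1}(coord_expand x) functional_sum; apply: eq_bigr => k _; rewrite functionalZ.
Qed.

End ScalarMap.

Lemma eq_characters x y : (forall i, chi i x = chi i y) -> x = y.
Proof.
move=> xy; apply/eqP; rewrite -subr_eq0 -scaleN1r; apply/eqP/chi_inj => i.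
by rewrite (functionalD (chi_lin i)) (functionalZ (chi_lin i)) mulN1r xy subrr.
Qed.

(** The character table is a square matrix, invertible because the characters separate elements; the
    rows of its inverse are the coordinates of the primitive idempotents. *)
Lemma idempotents_exist : exists e : 'I_r.+1 -> A,
  forall i j, chi j (e i) = (i == j)%:R.
Proof.
pose M : 'M[C]_r.+1 := \matrix_(k, i) chi i (b k).
have chi_row (v : 'rV[C]_r.+1) i :
    chi i (\sum_k v ord0 k *: b k) = (v *m M) ord0 i.
  rewrite (functional_sum (chi_lin i)) mxE; apply: eq_bigr => k _.
  by rewrite (functionalZ (chi_lin i)) mxE.
have Mu : M \in unitmx.
  rewrite unitmxE unitfE; apply/det0P => -[v v0 vM]; move/eqP: v0; apply.
  have x0 : \sum_k v ord0 k *: b k = 0.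
    by apply: chi_inj => i; rewrite chi_row vM mxE.
  apply/rowP => k; rewrite mxE.
  have := congr1 (co k) x0; rewrite linear0 linear_sum (bigD1 k) //= big1.
    by rewrite addr0 linearZ /= coord_tnth eqxx mulr1.
  by move=> j jk; rewrite linearZ /= coord_tnth (negPf jk) mulr0.
exists (fun i => \sum_k (row i (invmx M)) ord0 k *: b k) => i j.
by rewrite chi_row -row_mul mulVmx // !mxE.
Qed.

Lemma idem_expand (e : 'I_r.+1 -> A) x :
  (forall i j, chi j (e i) = (i == j)%:R) -> x = \sum_i chi i x *: e i.
Proof.
move=> eE; apply: eq_characters => j.
rewrite (functional_sum (chi_lin j)) (bigD1 j) //= big1.
  by rewrite addr0 (functionalZ (chi_lin j)) eE eqxx mulr1.
by move=> i ij; rewrite (functionalZ (chi_lin j)) eE (negPf ij) mulr0.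
Qed.

(** As [f 1 = 1] and 1 is the sum of the idempotents, some [f (e j)] is nonzero; then
    [x * e j = chi j x *: e j] determines [f]. *)
Lemma character_classify (f : A -> C) : scalar f -> f 1 = 1 ->
  {morph f : x y / x * y} -> exists j, f =1 chi j.
Proof.
move=> f_lin f1 fM; have [e eE] := idempotents_exist.
have [j fj] : exists j, f (e j) != 0.
  apply/existsP; apply: contraT; rewrite negb_exists => /forallP fe.
  have := f1; rewrite (idem_expand 1 eE) (functional_sum f_lin) big1.
    by move=> /esym/eqP; rewrite oner_eq0.
  by move=> i _; rewrite (functionalZ f_lin) (eqP (negPn (fe i))) mulr0.
exists j => x; apply: (mulIf fj); rewrite -fM -(functionalZ f_lin); congr f.
apply: eq_characters => i; rewrite chiM (functionalZ (chi_lin i)) eE.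
by case: eqVneq => [->|]; rewrite ?mulr0.
Qed.

Lemma structure_nat i j k : exists n : nat, co k (b i * b j) = n%:R.
Proof. exact: ita_integral hI i j k. Qed.

(** Conjugating the values on the basis and extending linearly gives a multiplicative map, since the
    structure constants are integers. *)
Lemma conj_character i : exists j, forall k, chi j (b k) = (chi i (b k))^*.
Proof.
pose f x := \sum_k co k x * (chi i (b k))^*.
have f_lin : scalar f.
  move=> c x y; rewrite /f mulr_sumr -big_split; apply: eq_bigr => k _ /=.
  by rewrite linearP /= mulrDl mulrA.
have fb k : f (b k) = (chi i (b k))^*.
  rewrite /f (bigD1 k) //= big1 ?coord_tnth ?eqxx ?mul1r ?addr0 // => j jk.
  by rewrite coord_tnth eq_sym (negPf jk) mul0r.
have f1 : f 1 = 1 by rewrite -(ita_one hI) fb (ita_one hI) chi1 conjC1.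
suff fM : {morph f : x y / x * y}.
  have [j fj] := character_classify f_lin f1 fM.
  by exists j => k; rewrite -fj fb.
move=> x y.
have fbb k l : f (b k * b l) = f (b k) * f (b l).
  rewrite !fb -rmorphM -chiM [in RHS](functional_expand (chi_lin i)) rmorph_sum /f.
  apply: eq_bigr => j _; have [n ->] := structure_nat k l j.
  by rewrite rmorphM /= conjC_nat.
rewrite {1}(coord_expand x) mulr_suml (functional_sum f_lin).
rewrite [in RHS](functional_expand f_lin x) mulr_suml; apply: eq_bigr => k _.
rewrite -scalerAl (functionalZ f_lin) -mulrA; congr (_ * _).
rewrite {1}(coord_expand y) mulr_sumr (functional_sum f_lin).
rewrite [in RHS](functional_expand f_lin y) mulr_sumr; apply: eq_bigr => l _.
by rewrite -scalerAr (functionalZ f_lin) fbb mulrCA.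
Qed.

Variable e : 'I_r.+1 -> A.
Hypothesis eE : forall i j, chi j (e i) = (i == j)%:R.

Lemma mul_idem x i : x * e i = chi i x *: e i.
Proof.
apply: eq_characters => j; rewrite chiM (functionalZ (chi_lin j)) eE.
by case: eqVneq => [->|]; rewrite ?mulr0.
Qed.

Lemma idem_neq0 i : e i != 0.
Proof.
apply/eqP => e0; have := eE i i; rewrite e0 eqxx (functional0 (chi_lin i)).
by move=> /esym/eqP; rewrite oner_eq0.
Qed.

(** By positivity [e j * star (e j)] is nonzero, so [chi j] is 1 at the idempotent [star (e j)]; the
    products [star (e i) * star (e j)] vanish for distinct indices. *)
Lemma star_idem i : star (e i) = e i.
Proof.
have ee j : star (e j) * star (e j) = star (e j).
  by rewrite -(starM hstar) mul_idem eE eqxx scale1r.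
have diag j : chi j (star (e j)) = 1.
  have nz : chi j (star (e j)) != 0.
    apply: contraNneq (idem_neq0 j) => z; apply/eqP/form_eq0.
    by rewrite hc mul_idem z scale0r linear0.
  by apply: (mulfI nz); rewrite -chiM ee mulr1.
apply: eq_characters => j; rewrite eE; case: eqVneq => [<-|ij]; first exact: diag.
rewrite -[LHS]mulr1 -(diag j) -chiM -(starM hstar) mul_idem eE.
by rewrite eq_sym (negPf ij) scale0r star0 (functional0 (chi_lin j)).
Qed.

Lemma character_star i x : chi i (star x) = (chi i x)^*.
Proof.
have := congr1 star (mul_idem x i); rewrite (starM hstar) (starZ hstar) star_idem.
move=> /(congr1 (chi i)); rewrite chiM (functionalZ (chi_lin i)) eE eqxx mul1r => ->.
by rewrite mulr1.
Qed.

Local Notation c i := (co ord0 (e i)).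

Lemma coord0_characters x : co ord0 x = \sum_i c i * chi i x.
Proof.
rewrite {1}(idem_expand x eE) linear_sum; apply: eq_bigr => i _.
by rewrite linearZ /= mulrC.
Qed.

Lemma weight_gt0 i : 0 < c i.
Proof.
have -> : c i = co ord0 (e i * star (e i)).
  by rewrite star_idem mul_idem eE eqxx scale1r.
rewrite lt_def formE sumr_ge0 => [|k _]; last first.
  by rewrite mulr_ge0 ?mul_conjC_ge0 // ltW ?degree_gt0.
rewrite andbT -formE; apply: contra (idem_neq0 i) => /eqP.
by move=> /form_eq0->.
Qed.

Lemma weight_neq0 i : c i != 0.
Proof. by rewrite gt_eqF // weight_gt0. Qed.

Lemma coord_idem k i : co k (e i) = c i * (chi i (b k))^* / delta k.
Proof.
by rewrite coord_form hc mul_idem linearZ /= character_star [X in X / _]mulrC.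
Qed.

(** This is [chi i (e j)] expanded through the coordinates of [e j] given by [coord_idem]. *)
Lemma character_orthogonality i j :
  \sum_k chi i (b k) * (chi j (b k))^* / delta k = (i == j)%:R / c i.
Proof.
rewrite -[LHS](mulKf (weight_neq0 j)).
have -> : c j * \sum_k chi i (b k) * (chi j (b k))^* / delta k = chi i (e j).
  rewrite (functional_expand (chi_lin i)) mulr_sumr; apply: eq_bigr => k _.
  by rewrite (coord_idem k j); ring.
by rewrite eE eq_sym; case: eqVneq => [->|]; rewrite ?mulr0 ?mul0r // mulrC.
Qed.

Lemma character_eigen i x : eigenvalue (regmx B x) (chi i x).
Proof.
apply/eigenvalueP; exists (\row_k chi i (b k)).
  apply/rowP => j; rewrite !mxE -chiM (functional_expand (chi_lin i)).
  by apply: eq_bigr => k _; rewrite !mxE mulrC.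
apply/eqP => /rowP/(_ ord0); rewrite !mxE (ita_one hI) chi1 => /eqP.
by rewrite oner_eq0.
Qed.

(** * The degree character by a Perron-Frobenius argument *)

Let absA x := \sum_k `|co k x| *: b k.

Lemma coord_abs k x : co k (absA x) = `|co k x|.
Proof.
rewrite linear_sum (bigD1 k) //= big1.
  by rewrite addr0 linearZ /= coord_tnth eqxx mulr1.
by move=> j jk; rewrite linearZ /= coord_tnth (negPf jk) mulr0.
Qed.

Lemma coord_mul k x y : co k (x * y) = \sum_j co j y * co k (x * b j).
Proof.
rewrite {1}(coord_expand y) mulr_sumr linear_sum; apply: eq_bigr => j _.
by rewrite -scalerAr linearZ.
Qed.

Lemma coord_mul_abs x y k : (forall j, 0 <= co k (x * b j)) ->
  `|co k (x * y)| <= co k (x * absA y).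
Proof.
move=> x0; rewrite !coord_mul; apply: le_trans (ler_norm_sum _ _ _) _.
by apply: ler_sum => j _; rewrite coord_abs normrM [ `|co k _|]ger0_norm.
Qed.

Let S := \sum_j b j.

Lemma star_sum_basis : star S = S.
Proof.
have [s sE] := fin_all_exists star_basis.
have s_inj : injective s.
  move=> i j ij; apply: tnth_basis_inj; apply: (can_inj (starK hstar)).
  by rewrite !sE ij.
by rewrite star_sum [RHS](reindex_inj s_inj); apply: eq_bigr => i _; rewrite sE.
Qed.

Lemma coord_sum_basis k : co k S = 1.
Proof.
rewrite linear_sum (bigD1 k) //= big1 ?coord_tnth ?eqxx ?addr0 // => j jk.
by rewrite coord_tnth (negPf jk).
Qed.

Lemma coord_sum_basisM_ge0 j k : 0 <= co k (S * b j).
Proof.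
rewrite mulr_suml linear_sum sumr_ge0 // => i _ /=.
by have [n ->] := structure_nat i j k; rewrite ler0n.
Qed.

Lemma form_characters x y :
  co ord0 (x * y * star y) = \sum_i c i * chi i x * `|chi i y| ^+ 2.
Proof.
rewrite coord0_characters; apply: eq_bigr => i _.
by rewrite !chiM character_star normCK !mulrA.
Qed.

(* Perron-Frobenius without limits: for the self-adjoint [S], replacing the
   coordinates of an eigenvector for the largest character value by their moduli
   does not decrease the Rayleigh quotient, so it is again an eigenvector. *)
Lemma degree_character : exists i, forall j, chi i (b j) = delta j.
Proof.
have S_real i : chi i S \is Num.real.
  by apply/CrealP; rewrite -character_star star_sum_basis.
have [i0 _ i0_max] := real_arg_maxP (isT : xpredT ord0) (fun i _ => S_real i).
move: i0_max; set rho := chi i0 S => i0_max.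
have rho_real : rho \is Num.real by apply: S_real.
have abs_eigen v : S * v = rho *: v -> S * absA v = rho *: absA v.
  move=> Sv; pose y := absA v.
  have le1 : rho * co ord0 (y * star y) <= co ord0 (S * y * star y).
    rewrite !formE mulr_sumr; apply: ler_sum => k _.
    rewrite !mulrA; apply: ler_wpM2r; first exact/ltW/degree_gt0.
    apply: ler_wpM2r; first by rewrite coord_abs conjC_ge0.
    have := coord_mul_abs v (fun j => coord_sum_basisM_ge0 j k).
    rewrite Sv linearZ normrM coord_abs; apply: le_trans.
    by rewrite ler_wpM2r // real_ler_norm.
  (* Expanding the Rayleigh inequality [le1] over characters gives a sum of nonnegative terms that
     is at most 0, so [y] is supported where [chi i S] is [rho]. *)
  have le2 : \sum_i c i * (rho - chi i S) * `|chi i y| ^+ 2 <= 0.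
    have yy : co ord0 (y * star y) = \sum_i c i * `|chi i y| ^+ 2.
      rewrite -[X in X * star y](mul1r y) form_characters.
      by apply: eq_bigr => i _; rewrite chi1 mulr1.
    suff -> : \sum_i c i * (rho - chi i S) * `|chi i y| ^+ 2
        = rho * co ord0 (y * star y) - co ord0 (S * y * star y).
      by rewrite subr_le0.
    rewrite yy form_characters mulr_sumr -sumrB.
    by apply: eq_bigr => i _; ring.
  have ge0 i : 0 <= c i * (rho - chi i S) * `|chi i y| ^+ 2.
    apply: mulr_ge0; last exact: exprn_ge0.
    by rewrite mulr_ge0 ?(ltW (weight_gt0 i)) // subr_ge0; apply: i0_max.
  apply: eq_characters => i; rewrite chiM (functionalZ (chi_lin i)).
  have /eqP : \sum_i c i * (rho - chi i S) * `|chi i y| ^+ 2 = 0.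
    by apply/le_anti; rewrite le2 sumr_ge0.
  rewrite psumr_eq0 // => /allP/(_ i (mem_index_enum _)) /=.
  rewrite -mulrA mulf_eq0 (negPf (weight_neq0 i)) mulf_eq0 sqrf_eq0 normr_eq0 /=.
  by rewrite subr_eq0 => /orP[]/eqP->; rewrite ?mulr0.
(* Simplicity of [rho]: the coefficient of 1 in [S * absA v] is the sum of the moduli of the
   coordinates weighted by degrees, so it vanishes only for [v = 0]. Two idempotents with eigenvalue
   [rho] could be combined to violate this. *)
have eigen0 v : S * v = rho *: v -> co ord0 v = 0 -> v = 0.
  move=> /abs_eigen Sv v0; have := congr1 (co ord0) Sv.
  rewrite linearZ /= coord_abs v0 normr0 mulr0 -star_sum_basis hc formE => /eqP.
  rewrite psumr_eq0 => [/allP vk|k _]; last first.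
    rewrite coord_sum_basis conjC1 mulr1 coord_abs.
    by rewrite mulr_ge0 ?normr_ge0 ?(ltW (degree_gt0 k)).
  rewrite (coord_expand v) big1 // => k _; have := vk k (mem_index_enum _).
  rewrite coord_sum_basis conjC1 mulr1 coord_abs mulf_eq0 (negPf (degree_neq0 k)) orbF.
  by rewrite normr_eq0 => /eqP->; rewrite scale0r.
have idem_eigen i : S * e i = chi i S *: e i by apply: mul_idem.
have rho_neq i : i != i0 -> chi i S != rho.
  move=> ii0; apply/eqP => iS; pose v := c i *: e i0 - c i0 *: e i.
  have Sv : S * v = rho *: v.
    rewrite mulrBr -!scalerAr !idem_eigen iS scalerBr !scalerA.
    by rewrite ![_ * rho]mulrC.
  have v0 : co ord0 v = 0 by rewrite linearB !linearZ /= mulrC subrr.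
  have := congr1 (chi i0) (eigen0 v Sv v0).
  rewrite (functional0 (chi_lin i0)) (functionalB (chi_lin i0)) !(functionalZ (chi_lin i0)).
  rewrite !eE eqxx (negPf ii0) mulr1 mulr0 subr0 => /eqP.
  by rewrite (negPf (weight_neq0 i)).
have abs_idem : absA (e i0) = e i0.
  set y := absA _; have y_neq i : i != i0 -> chi i y = 0.
    move=> ii0; have /(congr1 (chi i)) := abs_eigen _ (idem_eigen i0).
    rewrite chiM (functionalZ (chi_lin i)) => /eqP.
    by rewrite -subr_eq0 -mulrBl mulf_eq0 subr_eq0 (negPf (rho_neq i ii0)) => /eqP.
  have yE : y = chi i0 y *: e i0.
    rewrite {1}(idem_expand y eE) (bigD1 i0) //= big1 ?addr0 // => i ii0.
    by rewrite y_neq // scale0r.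
  suff -> : y = 1 *: e i0 by rewrite scale1r.
  rewrite {1}yE; congr (_ *: _); apply: (mulIf (weight_neq0 i0)).
  have := congr1 (co ord0) yE; rewrite linearZ /= {1}/y coord_abs mul1r => <-.
  by rewrite ger0_norm // ltW ?weight_gt0.
have chi_ge0 k : 0 <= chi i0 (b k).
  have : 0 <= co k (e i0) by rewrite -abs_idem coord_abs.
  rewrite coord_idem pmulr_lge0 ?invr_gt0 ?degree_gt0 // pmulr_rge0 ?weight_gt0 //.
  by rewrite conjC_ge0.
(* Apply [chi i0], nonnegative on the basis, to the coordinatewise inequality obtained by taking
   moduli in [b k * e i = chi i (b k) *: e i]. *)
have chi_max i k : `|chi i (b k)| <= chi i0 (b k).
  set y := absA (e i); have y_gt0 : 0 < chi i0 y.
    rewrite (functional_expand (chi_lin i0)) (bigD1 ord0) //= (ita_one hI) chi1 mulr1.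
    rewrite /y coord_abs ger0_norm ?(ltW (weight_gt0 i)) // ltr_pwDl ?weight_gt0 //.
    by apply: sumr_ge0 => j _; rewrite coord_abs mulr_ge0.
  rewrite -(ler_pM2r y_gt0) -chiM !(functional_expand (chi_lin i0)) mulr_sumr.
  apply: ler_sum => j _; rewrite mulrA ler_wpM2r //.
  rewrite coord_abs -normrM -linearZ -mul_idem; apply: coord_mul_abs => l.
  by have [n ->] := structure_nat k l j; rewrite ler0n.
(* The maximal eigenvalue [delta k] is some character value, hence at most [chi i0 (b k)]; the
   latter is an eigenvalue, hence at most [delta k]. *)
exists i0 => k; have [ev mx] := sita_degree hS k.
have [i di] := chi_eigen ev.
apply/le_anti; rewrite -[chi i0 _]ger0_norm // mx ?character_eigen //=.
by rewrite ger0_norm // -[delta k]ger0_norm ?(ltW (degree_gt0 k)) // di chi_max.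
Qed.

End Characters.

End TableAlgebra.

(** * Character tables with integral multiplicities *)

Record is_character_table (C : numClosedFieldType) (A : falgType C)
    (star : A -> A) (r : nat) (B : r.+1.-tuple A) (delta : 'I_r.+1 -> C)
    (chi : 'I_r.+1 -> A -> C) (m : 'I_r.+1 -> nat) : Prop := IsCharacterTable {
  ct_scalar : forall i, scalar (chi i);
  ct_one : forall i, chi i 1 = 1;
  ct_mul : forall i, {morph chi i : x y / x * y};
  ct_inj : forall x, (forall i, chi i x = 0) -> x = 0;
  ct_eigen : forall x a, eigenvalue (regmx B x) a -> exists i, a = chi i x;
  ct_trace : forall x, \tr (regmx B x) = \sum_i chi i x;
  ct_star : forall i x, chi i (star x) = (chi i x)^*;
  ct_conj : forall i, exists j, forall k,
    chi j (tnth B k) = (chi i (tnth B k))^*;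
  ct_mult_gt0 : forall i, (0 < m i)%N;
  ct_coord0 : forall x,
    table_order delta * coord B ord0 x = \sum_i (m i)%:R * chi i x;
  ct_orth : forall i j,
    \sum_k chi i (tnth B k) * (chi j (tnth B k))^* / delta k
      = (i == j)%:R * table_order delta / (m i)%:R;
  ct_degree : exists i, forall k, chi i (tnth B k) = delta k }.

(** The multiplicity hypothesis ranges over bundled morphisms, whereas the characters were built as
    plain functions. *)
Lemma lrmorphism_exists (C : numClosedFieldType) (A : falgType C) (f : A -> C) :
  scalar f -> f 1 = 1 -> {morph f : x y / x * y} ->
  exists g : {lrmorphism A -> C | *%R}, g =1 f.
Proof.
move=> fl f1 fM.
pose l := GRing.isLinear.Build C A C *%R f fl.
pose mm := GRing.isMonoidMorphism.Build A C f (conj f1 fM).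
pose g : {lrmorphism A -> C | *%R} := HB.pack f l mm.
by exists g.
Qed.

Lemma table_order_gt0 (C : numClosedFieldType) (A : falgType C) (star : A -> A)
    (r : nat) (B : r.+1.-tuple A) (delta : 'I_r.+1 -> C) :
  is_SITA star B delta -> 0 < table_order delta.
Proof.
move=> hS; rewrite /table_order (bigD1 ord0) //= ltr_pwDl ?(degree_gt0 hS) //.
by apply: sumr_ge0 => i _; apply/ltW/(degree_gt0 hS).
Qed.

Lemma character_table_exists (C : numClosedFieldType) (A : falgType C)
    (star : A -> A) (r : nat) (B : r.+1.-tuple A) (delta : 'I_r.+1 -> C) :
  is_SITAwIM star B delta ->
  exists chi m, is_character_table star B delta chi m.
Proof.
move=> [hS hc hm]; have [chi [chi_lin chi1 chiM chi_inj chi_tr]] :=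
  characters_exist hS hc.
have chi_eig x := (chi_tr x).2.
have [e eE] := idempotents_exist hS chi_lin chi_inj.
have n0 := lt0r_neq0 (table_order_gt0 hS).
have chi_star := character_star hS hc chi_lin chiM chi_inj eE.
have orth := character_orthogonality hS hc chi_lin chiM chi_inj eE.
have c0 := weight_neq0 hS hc chi_lin chiM chi_inj eE.
(* The definition of the multiplicity and the orthogonality relation evaluate the same sum, which
   identifies the weight of [e i] with multiplicity over order. *)
have mex i : exists k : nat,
    (0 < k)%N /\ coord B ord0 (e i) = k%:R / table_order delta.
  have [g gE] := lrmorphism_exists (chi_lin i) (chi1 i) (chiM i).
  have [k k0 p] := hm g; exists k; split=> //.
  have kn0 : k%:R != 0 :> C by rewrite pnatr_eq0 -lt0n.
  move: p; rewrite /is_multiplicity.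
  under eq_bigr do rewrite gE normCK.
  rewrite orth eqxx => p; apply: invr_inj; rewrite invf_div -p mul1r //.
have [m mE] := fin_all_exists mex.
exists chi, m; split=> //.
- by move=> x; have [] := chi_tr x.
- by move=> i; apply: (conj_character hS chi_lin chi1 chiM chi_inj i).
- by move=> i; have [] := mE i.
- move=> x; rewrite (coord0_characters B chi_lin chi_inj eE) mulr_sumr.
  apply: eq_bigr => i _; rewrite mulrA (mE i).2; congr (_ * _).
  by rewrite mulrC divfK.
- move=> i j; rewrite orth; case: eqVneq => [->|]; rewrite ?mul0r // (mE j).2.
  by rewrite invf_div mulrA.
exact: (degree_character hS hc chi_lin chi1 chiM chi_inj chi_eig eE).
Qed.

(** * The integral span of the basis and rational character sums *)

Definition integral_coords (C : numClosedFieldType) (A : falgType C) (r : nat)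
    (B : r.+1.-tuple A) (x : A) : Prop :=
  forall k, exists z : int, coord B k x = z%:~R.

Section IntegralElements.
Variables (C : numClosedFieldType) (A : falgType C) (star : A -> A) (r : nat).
Variables (B : r.+1.-tuple A) (delta : 'I_r.+1 -> C).
Variables (chi : 'I_r.+1 -> A -> C) (m : 'I_r.+1 -> nat).
Hypothesis hS : is_SITA star B delta.
Hypothesis hX : is_character_table star B delta chi m.
Implicit Types x y : A.

Lemma int_sum (I : Type) (s : seq I) (F : I -> C) :
  (forall i, exists z : int, F i = z%:~R) ->
  exists z : int, \sum_(i <- s) F i = z%:~R.
Proof.
move=> hF; elim: s => [|i s [z IH]]; first by exists 0; rewrite big_nil.
by have [w e] := hF i; exists (w + z); rewrite big_cons IH e intrD.
Qed.

Lemma integral_tnth k : integral_coords B (tnth B k).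
Proof.
by move=> j; exists (k == j)%:Z; rewrite (coord_tnth hS); case: eqP.
Qed.

Lemma integralD x y :
  integral_coords B x -> integral_coords B y -> integral_coords B (x + y).
Proof.
move=> hx hy k; have [z ez] := hx k; have [w ew] := hy k.
by exists (z + w); rewrite linearD /= ez ew intrD.
Qed.

Lemma integralB x y :
  integral_coords B x -> integral_coords B y -> integral_coords B (x - y).
Proof.
move=> hx hy k; have [z ez] := hx k; have [w ew] := hy k.
by exists (z - w); rewrite linearB /= ez ew intrB.
Qed.

Lemma integralM x y :
  integral_coords B x -> integral_coords B y -> integral_coords B (x * y).
Proof.
move=> hx hy k; rewrite (coord_mul hS); apply: int_sum => j.
have [z ->] := hy j; rewrite (coord_expand hS x) mulr_suml linear_sum.
have [|w ->] := @int_sum _ (index_enum _)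
    (fun i => coord B k (coord B i x *: tnth B i * tnth B j)).
  move=> i; have [w ew] := hx i.
  have [n en] := structure_nat hS i j k.
  by exists (w * n); rewrite -scalerAl linearZ /= ew en intrM -pmulrn.
by exists (z * w); rewrite intrM.
Qed.

(** The sum over all characters is the trace of a regular matrix with integer entries. *)
Lemma integral_trace x : integral_coords B x ->
  exists z : int, \sum_i chi i x = z%:~R.
Proof.
move=> hx; rewrite -(ct_trace hX); apply: int_sum => i; rewrite mxE.
by apply: integralM => //; apply: integral_tnth.
Qed.

Lemma integral_degree i x : (forall k, chi i (tnth B k) = delta k) ->
  integral_coords B x -> exists z : int, chi i x = z%:~R.
Proof.
move=> di hx; rewrite (functional_expand hS (ct_scalar hX i)); apply: int_sum => k.
have [z ->] := hx k; have [n _ en] := degree_nat hS k.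
by exists (z * n); rewrite di en intrM -pmulrn.
Qed.

End IntegralElements.

(** * Two asymmetric pairs *)

Section TwoPairs.
Variables (C : numClosedFieldType) (A : falgType C) (star : A -> A).
Variables (B : 5.-tuple A) (delta : 'I_5 -> C) (b1 b3 : A).
Variables (chi : 'I_5 -> A -> C) (m : 'I_5 -> nat).
Hypotheses (hS : is_SITA star B delta) (hc : commutative (@GRing.mul A)).
Hypothesis hX : is_character_table star B delta chi m.
Hypothesis hform : B = [tuple 1; b1; star b1; b3; star b3].
Hypothesis hb1 : star b1 <> b1.

Let hstar := ita_involution (sita_ita hS).
Let k1 : 'I_5 := @Ordinal 5 1 isT.
Let k2 : 'I_5 := @Ordinal 5 2 isT.
Let k3 : 'I_5 := @Ordinal 5 3 isT.
Let k4 : 'I_5 := @Ordinal 5 4 isT.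

Lemma tnth_form : [/\ tnth B ord0 = 1, tnth B k1 = b1, tnth B k2 = star b1,
  tnth B k3 = b3 & tnth B k4 = star b3].
Proof. by rewrite hform !(tnth_nth 0). Qed.

Lemma sum_ord5 (F : 'I_5 -> C) :
  \sum_i F i = F ord0 + F k1 + F k2 + F k3 + F k4.
Proof.
rewrite !big_ord_recl big_ord0 addr0 !addrA.
by congr (_ + F _ + F _ + F _ + F _); apply: val_inj.
Qed.

Lemma degree_form :
  [/\ delta ord0 = 1, delta k2 = delta k1 & delta k4 = delta k3].
Proof.
have [t0 t1 t2 t3 t4] := tnth_form.
have st := sita_standard hS; split; rewrite -!st.
- by rewrite t0 (star1 hS) mulr1 -t0 (coord_tnth hS).
- by rewrite t1 t2 (starK hstar) hc.
- by rewrite t3 t4 (starK hstar) hc.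
Qed.

(** With [cp_uniq], the five indices exhaust all characters. *)
Record conj_pairs (i0 i1 j1 i3 j3 : 'I_5) : Prop := ConjPairs {
  cp_degree : forall k, chi i0 (tnth B k) = delta k;
  cp_conj1 : forall k, chi j1 (tnth B k) = (chi i1 (tnth B k))^*;
  cp_conj3 : forall k, chi j3 (tnth B k) = (chi i3 (tnth B k))^*;
  cp_uniq : uniq [:: i0; i1; j1; i3; j3] }.

Lemma conj_pairs_sym i0 i1 j1 i3 j3 :
  conj_pairs i0 i1 j1 i3 j3 -> conj_pairs i0 i3 j3 i1 j1.
Proof.
move=> [h0 h1 h3 u]; split=> //; rewrite -(perm_uniq (s1 := [:: i0; i1; j1; i3; j3])) //.
by rewrite perm_cons (perm_catC [:: i1; j1] [:: i3; j3]).
Qed.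

Lemma conj_pairs_sum i0 i1 j1 i3 j3 (F : 'I_5 -> C) :
  conj_pairs i0 i1 j1 i3 j3 ->
  \sum_i F i = F i0 + F i1 + F j1 + F i3 + F j3.
Proof.
move=> [_ _ _ u].
have sub : {subset [:: i0; i1; j1; i3; j3] <= enum 'I_5}.
  by move=> i _; rewrite mem_enum.
have [|_ eqi] := uniq_min_size u sub; first by rewrite size_enum_ord.
rewrite (perm_big [:: i0; i1; j1; i3; j3]) /=.
  by rewrite !big_cons big_nil addr0 !addrA.
by apply: uniq_perm; rewrite ?index_enum_uniq // => i; rewrite eqi mem_enum mem_index_enum.
Qed.

Lemma conj_difference i j x :
  (forall k, chi j (tnth B k) = (chi i (tnth B k))^*) ->
  x \in [:: b1; b3] -> chi j (x - star x) = - chi i (x - star x).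
Proof.
move=> ij; have [t0 t1 t2 t3 t4] := tnth_form.
rewrite (functionalB (ct_scalar hX i)) (functionalB (ct_scalar hX j)) opprB !inE.
move=> /orP[]/eqP->; [rewrite -t2 -t1 !ij t1 t2 | rewrite -t4 -t3 !ij t3 t4];
  by rewrite !(ct_star hX) conjCK.
Qed.

(** Values at [b1 - star b1] and [b3 - star b3] vanish at the degree character and change sign under
    conjugation, so they can separate five characters. *)
Lemma conj_pairs_exist : exists i0 i1 j1 i3 j3, conj_pairs i0 i1 j1 i3 j3.
Proof.
have [i0 h0] := ct_degree hX; have [t0 t1 t2 t3 t4] := tnth_form.
have [d0 d12 d34] := degree_form.
have chi_neq0 x : x != 0 -> exists i, chi i x != 0.
  move=> x0; apply/existsP; apply: contraNT x0; rewrite negb_exists => /forallP x0.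
  by apply/eqP/(ct_inj hX) => i; apply/eqP/negPn.
pose D i := chi i (b1 - star b1); pose E i := chi i (b3 - star b3).
have [i1 x0] : exists i, D i != 0.
  by apply: chi_neq0; rewrite subr_eq0 eq_sym; apply/eqP.
have [j1 h1] := ct_conj hX i1.
(* This combination vanishes at the degree character and on the first pair. It is not identically 0,
   since the element it comes from has coefficient [- D i1] at [b3]; any [i3] where it is nonzero
   lies in a new pair. *)
pose V i := E i1 * D i - D i1 * E i.
have [i3 v0] : exists i, V i != 0.
  have [|i vi] := chi_neq0 (E i1 *: (b1 - star b1) - D i1 *: (b3 - star b3)).
    apply: contra_neq x0 => /(congr1 (coord B k3)).
    rewrite linear0 linearB !linearZ !linearB /= -t2 -t4 -t1 -t3.
    rewrite !(coord_tnth hS) -!val_eqE /= subrr mulr0 sub0r subr0 mulr1.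
    by move/eqP; rewrite oppr_eq0 => /eqP.
  by exists i; rewrite /V -!(functionalZ (ct_scalar hX i)) -(functionalB (ct_scalar hX i)).
have [j3 h3] := ct_conj hX i3.
exists i0, i1, j1, i3, j3; split=> //.
have Dj1 : D j1 = - D i1 by apply: conj_difference => //; rewrite !inE eqxx.
have Ej1 : E j1 = - E i1 by apply: conj_difference => //; rewrite !inE eqxx orbT.
have Dj3 : D j3 = - D i3 by apply: conj_difference => //; rewrite !inE eqxx.
have Ej3 : E j3 = - E i3 by apply: conj_difference => //; rewrite !inE eqxx orbT.
have Di0 : D i0 = 0.
  by rewrite /D (functionalB (ct_scalar hX i0)) -t2 -{1}t1 !h0 d12 subrr.
have Ei0 : E i0 = 0.
  by rewrite /E (functionalB (ct_scalar hX i0)) -t4 -{1}t3 !h0 d34 subrr.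
have Vi0 : V i0 = 0 by rewrite /V Di0 Ei0 !mulr0 subrr.
have Vi1 : V i1 = 0 by rewrite /V mulrC subrr.
have Vj1 : V j1 = 0 by rewrite /V Dj1 Ej1; ring.
have Vj3 : V j3 = - V i3 by rewrite /V Dj3 Ej3; ring.
have neq (f : 'I_5 -> C) i j : f i != f j -> i != j by apply: contra_neq => ->.
have opp (z : C) : z != 0 -> z != - z by rewrite -addr_eq0 -mulr2n mulrn_eq0.
rewrite /= !inE !negb_or !andbT; do !(apply/andP; split).
- by apply: (neq D); rewrite Di0 eq_sym.
- by apply: (neq D); rewrite Di0 Dj1 eq_sym oppr_eq0.
- by apply: (neq V); rewrite Vi0 eq_sym.
- by apply: (neq V); rewrite Vi0 Vj3 eq_sym oppr_eq0.
- by apply: (neq D); rewrite Dj1 opp.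
- by apply: (neq V); rewrite Vi1 eq_sym.
- by apply: (neq V); rewrite Vi1 Vj3 eq_sym oppr_eq0.
- by apply: (neq V); rewrite Vj1 eq_sym.
- by apply: (neq V); rewrite Vj1 Vj3 eq_sym oppr_eq0.
- by apply: (neq V); rewrite Vj3 opp.
Qed.

(** * Character values for equal and for distinct multiplicities *)

Section Eigenvalues.
Variables (i0 i1 j1 i3 j3 : 'I_5).
Hypothesis hP : conj_pairs i0 i1 j1 i3 j3.

Local Notation n := (table_order delta).

Lemma conj_pair_value i j x :
  (forall k, chi j (tnth B k) = (chi i (tnth B k))^*) ->
  x \in B -> chi j x = chi i (star x).
Proof. by move=> ij /tnthP[k ->]; rewrite ij (ct_star hX). Qed.

Lemma chi_star2 i x : chi i (star (star x)) = chi i x.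
Proof. by rewrite (starK hstar). Qed.

Lemma mem_form :
  [/\ 1 \in B, b1 \in B, star b1 \in B, b3 \in B & star b3 \in B].
Proof. by rewrite hform !inE !eqxx !orbT. Qed.

(** Conjugates are replaced by values at starred elements, which makes the relations polynomial. *)
Lemma orthogonality_form i j :
  1 + (chi i b1 * chi j (star b1) + chi i (star b1) * chi j b1) / delta k1
    + (chi i b3 * chi j (star b3) + chi i (star b3) * chi j b3) / delta k3
  = (i == j)%:R * n / (m i)%:R.
Proof.
have [t0 t1 t2 t3 t4] := tnth_form; have [d0 d12 d34] := degree_form.
rewrite -(ct_orth hX) sum_ord5 t0 t1 t2 t3 t4 -!(ct_star hX) !chi_star2.
rewrite (star1 hS) !(ct_one hX) d0 d12 d34 divr1; ring.
Qed.

Lemma order_form : n = 1 + 2 * delta k1 + 2 * delta k3.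
Proof.
have [d0 d12 d34] := degree_form.
by rewrite /table_order sum_ord5 d0 d12 d34; ring.
Qed.

Let n0 : n != 0 := lt0r_neq0 (table_order_gt0 hS).

Lemma mult_degree : m i0 = 1%N.
Proof.
have m0 := ct_mult_gt0 hX i0; apply/eqP; rewrite -(eqr_nat C) -subr_eq0.
have := ct_orth hX i0 i0; rewrite eqxx mul1r.
have -> : \sum_k chi i0 (tnth B k) * (chi i0 (tnth B k))^* / delta k = n.
  apply: eq_bigr => k _; rewrite (cp_degree hP).
  have [d d0 ->] := degree_nat hS k.
  by rewrite conjC_nat mulfK // pnatr_eq0 -lt0n.
move=> e; have : n * (m i0)%:R = n * 1.
  by rewrite {1}e divfK ?mulr1 // pnatr_eq0 -lt0n.
by move/(mulfI n0) => ->; rewrite subrr.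
Qed.

Lemma mult_conj i j : (forall k, chi j (tnth B k) = (chi i (tnth B k))^*) ->
  m j = m i.
Proof.
move=> ij; have mi := ct_mult_gt0 hX i; have mj := ct_mult_gt0 hX j.
have := ct_orth hX i i; have := ct_orth hX j j; rewrite !eqxx !mul1r.
have -> : \sum_k chi j (tnth B k) * (chi j (tnth B k))^* / delta k
   = \sum_k chi i (tnth B k) * (chi i (tnth B k))^* / delta k.
  by apply: eq_bigr => k _; rewrite ij conjCK [X in X / _]mulrC.
move=> -> /(mulfI n0)/invr_inj/eqP; rewrite eqr_nat => /eqP//.
Qed.

Lemma weighted_form x : n * coord B ord0 x
  = chi i0 x + (m i1)%:R * (chi i1 x + chi j1 x)
    + (m i3)%:R * (chi i3 x + chi j3 x).
Proof.
rewrite (ct_coord0 hX) (conj_pairs_sum _ hP) mult_degree.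
by rewrite (mult_conj (cp_conj1 hP)) (mult_conj (cp_conj3 hP)); ring.
Qed.

Lemma integral_pairs x : integral_coords B x ->
  exists z : int, chi i1 x + chi j1 x + (chi i3 x + chi j3 x) = z%:~R.
Proof.
move=> hx; have [z ez] := integral_trace hS hX hx.
have [w ew] := integral_degree hS hX (cp_degree hP) hx.
exists (z - w); rewrite intrB -ez -ew (conj_pairs_sum _ hP); ring.
Qed.

Lemma integral_form x : x \in B -> integral_coords B x.
Proof. by move=> /tnthP[k ->]; apply: (integral_tnth hS). Qed.

(** The plain and the weighted character sums are two linear equations for the two pair sums, with
    determinant [m i1 - m i3]. Pair sums at [x] and at [x * x] are therefore rational. *)
Lemma cyclotomic_distinct_mult x : m i1 != m i3 -> x \in B ->
  is_cyclotomic (chi i1 x).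
Proof.
move=> m13 xB; have rat_pair y : integral_coords B y ->
    exists q : rat, chi i1 y + chi j1 y = ratr q.
  move=> hy; have [z ez] := integral_pairs hy; have [c ec] := hy ord0.
  have [w ew] := integral_degree hS hX (cp_degree hP) hy.
  have := weighted_form y; rewrite ec ew order_form.
  have [k k0 ->] := degree_nat hS k1; have [l l0 ->] := degree_nat hS k3 => e.
  have m0 : (m i1)%:R - (m i3)%:R != 0 :> C by rewrite subr_eq0 eqr_nat.
  exists (((1 + 2 * k%:R + 2 * l%:R) * c%:~R - w%:~R - (m i3)%:R * z%:~R)
    / ((m i1)%:R - (m i3)%:R)).
  rewrite rmorphM fmorphV /= !(rmorphB, rmorphD, rmorphM, rmorph1) /=.
  rewrite !(rmorph_nat, ratr_int) e -ez; apply: (mulIf m0); rewrite divfK //.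
  ring.
have hx := integral_form xB.
have [p ep] := rat_pair _ hx; have [q eq] := rat_pair _ (integralM hS hx hx).
by apply: cyclotomic_quadratic ep _; rewrite !expr2 -!(ct_mul hX) eq.
Qed.

(** The weighted sum at a basis element other than 1 is 0, so the common multiplicity [M] divides
    each degree. At 1 it shows that the two degrees add up to 2 M; being positive multiples of [M],
    both equal [M]. *)
Lemma equal_mult_degree : m i1 = m i3 ->
  delta k1 = (m i1)%:R /\ delta k3 = (m i1)%:R.
Proof.
move=> m13; set M := m i1; have M0 : (0 < M)%N := ct_mult_gt0 hX i1.
have [t0 t1 t2 t3 t4] := tnth_form.
have int_degree k : k != ord0 -> exists z : int, delta k = (M%:Z * z)%:~R.
  move=> k0; have [z ez] := integral_pairs (integral_tnth hS k).
  have := weighted_form (tnth B k); rewrite (coord_tnth hS) (negPf k0) mulr0.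
  rewrite -m13 -/M -addrA -mulrDr ez (cp_degree hP) => /eqP.
  rewrite eq_sym addr_eq0 => /eqP->; exists (- z).
  by rewrite intrM rmorphN mulrN -pmulrn.
have [u eu] := int_degree k1 isT; have [v ev] := int_degree k3 isT.
have [k k0 ek] := degree_nat hS k1; have [l l0 el] := degree_nat hS k3.
have := weighted_form 1; rewrite -{1}t0 (coord_tnth hS) eqxx mulr1 order_form.
rewrite !(ct_one hX) -m13 -/M ek el => e.
have kl : (k + l = 2 * M)%N.
  apply/eqP; rewrite -(eqr_nat C) natrD natrM; apply/eqP.
  have : 2 * (k%:R + l%:R) = 2 * (2 * M%:R) :> C.
    transitivity (1 + 2 * k%:R + 2 * l%:R - 1 : C); first by ring.
    by rewrite e; ring.
  by apply: mulfI; rewrite pnatr_eq0.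
have kE : k%:Z = M%:Z * u by apply: (@intr_inj C); rewrite -eu ek -pmulrn.
have lE : l%:Z = M%:Z * v by apply: (@intr_inj C); rewrite -ev el -pmulrn.
suff [-> ->] : k = M /\ l = M by [].
have uv : u + v = 2.
  have M0' : M%:Z != 0 by rewrite eqz_nat -lt0n.
  apply: (mulfI M0'); rewrite mulrDr -kE -lE; lia.
have u0 : 0 < u by rewrite -(pmulr_rgt0 _ (_ : 0 < M%:Z)) // -kE.
have v0 : 0 < v by rewrite -(pmulr_rgt0 _ (_ : 0 < M%:Z)) // -lE.
have u1 : u = 1 by lia.
have v1 : v = 1 by lia.
by move: kE lE; rewrite u1 v1 !mulr1 => -[->] [->].
Qed.

(** With both degrees and both multiplicities equal to [K], the order is 4 K + 1, and clearing
    denominators in the orthogonality relations yields the hypotheses of [quartic_eigenvalues]. *)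
Lemma cyclotomic_equal_mult x :
  m i1 = m i3 -> x \in B -> is_cyclotomic (chi i1 x).
Proof.
move=> m13; have [e1 e3] := equal_mult_degree m13; set K := m i1 in e1 e3.
have K0 : K%:R != 0 :> C by rewrite pnatr_eq0 -lt0n (ct_mult_gt0 hX).
have [t0 t1 t2 t3 t4] := tnth_form; have [d0 d12 d34] := degree_form.
have [B0 B1 B2 B3 B4] := mem_form.
have nE : n = (4 * K + 1)%:R.
  by rewrite order_form e1 e3 natrD natrM; ring.
have [c1 c2 c3 c4] : [/\ chi i0 b1 = K%:R, chi i0 (star b1) = K%:R,
    chi i0 b3 = K%:R & chi i0 (star b3) = K%:R].
  by rewrite -t2 -t4 -t1 -t3 !(cp_degree hP) d12 d34 e1 e3.
have /and5P[u0 u1 u3 _ _] := cp_uniq hP.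
have [i01 i03] : i0 != i1 /\ i0 != i3.
  by move: u0; rewrite !inE !negb_or => /and4P[].
have [i13 i1j3] : i1 != i3 /\ i1 != j3.
  by move: u1; rewrite !inE !negb_or => /and3P[].
have val1 := conj_pair_value (cp_conj1 hP); have val3 := conj_pair_value (cp_conj3 hP).
have hb := integral_tnth hS.
pose s := b1 - star b1; pose t := b3 - star b3.
(* On [q] the two pairs take opposite values, of square [n]; the traces of
   [s ^+ 2 * q] and [s * t * q] supply the rationals in the quartic case. *)
pose q := b1 + star b1 - b3 - star b3.
have hs : integral_coords B s by rewrite /s -t2 -t1; apply: integralB.
have ht : integral_coords B t by rewrite /t -t4 -t3; apply: integralB.
have hq : integral_coords B q.
  rewrite /q -t2 -t4 -t1 -t3; apply: integralB => //; apply: integralB => //.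
  exact: integralD.
have [z1 ez1] := integral_pairs (integralM hS (integralM hS hs hs) hq).
have [z2 ez2] := integral_pairs (integralM hS (integralM hS hs ht) hq).
have chi_s i : chi i s = chi i b1 - chi i (star b1).
  by rewrite /s (functionalB (ct_scalar hX i)).
have chi_t i : chi i t = chi i b3 - chi i (star b3).
  by rewrite /t (functionalB (ct_scalar hX i)).
have chi_q i : chi i q = chi i b1 + chi i (star b1) - chi i b3 - chi i (star b3).
  by rewrite /q !(functionalB (ct_scalar hX i)) (functionalD (ct_scalar hX i)).
have half (z : int) : ratr (z%:~R / 2) = z%:~R / 2 :> C.
  by rewrite rmorphM fmorphV /= ratr_int rmorph_nat.
have norm_rows i : i != i0 -> m i = K ->
    2 * (chi i b1 * chi i (star b1) + chi i b3 * chi i (star b3)) = (3 * K + 1)%:R.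
  move=> ii0 mi; have := orthogonality_form i i; rewrite eqxx mi e1 e3 nE => e.
  have /(congr1 ( *%R K%:R)) := e; rewrite mul1r [RHS]mulrC divfK // => {}e.
  apply: (addrI K%:R); transitivity ((4 * K + 1)%:R : C); last first.
    by rewrite !(natrD _ (_ * _)) !natrM; ring.
  by rewrite -e; field.
(* Orthogonality to the degree character, whose values at [b1], [b3] and their stars are all [K]. *)
have sum_rows i : i != i0 -> 
    chi i b1 + chi i (star b1) + chi i b3 + chi i (star b3) = -1.
  move=> ii0; have := orthogonality_form i i0.
  rewrite (negPf ii0) !mul0r c1 c2 c3 c4 e1 e3 => e.
  by apply: (addrI 1); rewrite subrr -e; field.
have orth_rows i j : i != j ->
    chi i b1 * chi j (star b1) + chi i (star b1) * chi j b1
    + chi i b3 * chi j (star b3) + chi i (star b3) * chi j b3 = - K%:R.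
  move=> ij; have := orthogonality_form i j; rewrite (negPf ij) !mul0r e1 e3.
  move=> /(congr1 ( *%R K%:R)); rewrite mulr0 => e.
  by apply: (addrI K%:R); rewrite subrr -e; field.
have n1 : 2 * (chi i1 b1 * chi i1 (star b1) + chi i1 b3 * chi i1 (star b3))
    = (3 * K + 1)%:R by apply: norm_rows; rewrite // eq_sym.
have n3 : 2 * (chi i3 b1 * chi i3 (star b1) + chi i3 b3 * chi i3 (star b3))
    = (3 * K + 1)%:R by apply: norm_rows; rewrite // eq_sym.
have two0 : 2 != 0 :> C by rewrite pnatr_eq0.
have val1b : [/\ chi j1 b1 = chi i1 (star b1), chi j1 (star b1) = chi i1 b1,
    chi j1 b3 = chi i1 (star b3) & chi j1 (star b3) = chi i1 b3].
  by rewrite !val1 // !chi_star2.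
have val3b : [/\ chi j3 b1 = chi i3 (star b1), chi j3 (star b1) = chi i3 b1,
    chi j3 b3 = chi i3 (star b3) & chi j3 (star b3) = chi i3 b3].
  by rewrite !val3 // !chi_star2.
have [p1 p2 p3 p4] := val1b; have [r1 r2 r3 r4] := val3b.
have cols : chi i1 b1 + chi i1 (star b1) + chi i3 b1 + chi i3 (star b1) = -1.
  have := weighted_form b1; rewrite -{1}t1 (coord_tnth hS) mulr0 p1 r1 c1 -m13 -/K => e.
  apply: (mulfI K0); apply: (addrI K%:R).
  by rewrite mulrN1 subrr e; ring.
(* Column orthogonality: the coefficient of 1 in [b1 * star b1] is the degree [K]. *)
have norm_cols : chi i1 b1 * chi i1 (star b1) + chi i3 b1 * chi i3 (star b1)
    = chi i1 b1 * chi i1 (star b1) + chi i1 b3 * chi i1 (star b3).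
  apply: (mulfI two0); rewrite n1; have := weighted_form (b1 * star b1).
  rewrite -{1}t1 -{1}t1 (sita_standard hS) !(ct_mul hX) p1 p2 r1 r2 c1 c2 e1 nE.
  rewrite -m13 -/K => e; apply: (mulfI K0); apply: (addrI (K%:R * K%:R)).
  transitivity ((4 * K + 1)%:R * K%:R : C).
    by rewrite e; ring.
  by rewrite !(natrD _ (_ * _)) !natrM; ring.
have norm_eq : chi i3 b1 * chi i3 (star b1) + chi i3 b3 * chi i3 (star b3)
    = chi i1 b1 * chi i1 (star b1) + chi i1 b3 * chi i1 (star b3).
  by apply: (mulfI two0); rewrite n1 n3.
have o1 := orth_rows _ _ i13; have := orth_rows _ _ i1j3.
rewrite r1 r2 r3 r4 => o2.
move: ez1; rewrite !(ct_mul hX) !chi_s !chi_q p1 p2 p3 p4 r1 r2 r3 r4 => ez1.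
move: ez2; rewrite !(ct_mul hX) !chi_s !chi_t !chi_q p1 p2 p3 p4 r1 r2 r3 r4 => ez2.
have s1 : chi i1 b1 + chi i1 (star b1) + chi i1 b3 + chi i1 (star b3) = -1.
  by apply: sum_rows; rewrite eq_sym.
have s3 : chi i3 b1 + chi i3 (star b1) + chi i3 b3 + chi i3 (star b3) = -1.
  by apply: sum_rows; rewrite eq_sym.
(* Conjugation changes the sign of [s] and [t] and fixes [q], so both members of a pair contribute
   equally to the trace; hence the division by 2. *)
have tr1 : (chi i1 b1 - chi i1 (star b1)) ^+ 2
      * (chi i1 b1 + chi i1 (star b1) - chi i1 b3 - chi i1 (star b3))
    + (chi i3 b1 - chi i3 (star b1)) ^+ 2
      * (chi i3 b1 + chi i3 (star b1) - chi i3 b3 - chi i3 (star b3))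
    = ratr (z1%:~R / 2) by rewrite half -ez1; field.
have tr2 : (chi i1 b1 - chi i1 (star b1)) * (chi i1 b3 - chi i1 (star b3))
      * (chi i1 b1 + chi i1 (star b1) - chi i1 b3 - chi i1 (star b3))
    + (chi i3 b1 - chi i3 (star b1)) * (chi i3 b3 - chi i3 (star b3))
      * (chi i3 b1 + chi i3 (star b1) - chi i3 b3 - chi i3 (star b3))
    = ratr (z2%:~R / 2) by rewrite half -ez2; field.
have [ca ca' cb cb'] :=
  quartic_eigenvalues s1 cols s3 n1 norm_cols norm_eq o1 o2 tr1 tr2.
rewrite hform !inE => /or4P[/eqP->|/eqP->|/eqP->|/orP[]/eqP->] //.
by rewrite (ct_one hX); apply: (cyclotomic_nat C 1).
Qed.

Lemma cyclotomic_conj_pair x : x \in B ->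
  is_cyclotomic (chi i1 x) /\ is_cyclotomic (chi j1 x).
Proof.
have ci1 y : y \in B -> is_cyclotomic (chi i1 y).
  by move=> yB; have [|] := eqVneq (m i1) (m i3) => m13;
    [apply: cyclotomic_equal_mult | apply: cyclotomic_distinct_mult].
move=> xB; split; first exact: ci1.
rewrite (conj_pair_value (cp_conj1 hP)) //; apply: ci1.
by have /tnthP[k ->] := xB; apply: (ita_star (sita_ita hS)).
Qed.

End Eigenvalues.

Lemma cyclotomic_characters i x : x \in B -> is_cyclotomic (chi i x).
Proof.
move=> xB; have [i0 [i1 [j1 [i3 [j3 hP]]]]] := conj_pairs_exist.
have [c1 c1'] := cyclotomic_conj_pair hP xB.
have [c3 c3'] := cyclotomic_conj_pair (conj_pairs_sym hP) xB.
have sub : {subset [:: i0; i1; j1; i3; j3] <= enum 'I_5}.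
  by move=> j _; rewrite mem_enum.
have [|_ eqi] := uniq_min_size (cp_uniq hP) sub; first by rewrite size_enum_ord.
have := mem_enum 'I_5 i; rewrite -eqi !inE.
move=> /or4P[/eqP->|/eqP->|/eqP->|/orP[]/eqP->] //.
have /tnthP[k ->] := xB; rewrite (cp_degree hP).
by have [d _ ->] := degree_nat hS k; apply: cyclotomic_nat.
Qed.

End TwoPairs.

(** * Eigenvalues of basis elements as character values *)

Local Open Scope complex_scope.

Theorem theorem4p1 (R : realType) (A : falgType R[i]) (star : A -> A)
    (B : 5.-tuple A) (delta : 'I_5 -> R[i]) (hB : is_SITAwIM star B delta)
    (b1 b3 : A) (hform : B = [tuple 1; b1; star b1; b3; star b3])
    (hb1 : star b1 <> b1) (hb3 : star b3 <> b3)
    (b : A) (hb : b \in B) (a : R[i]) (ha : eigenvalue (regmx B b) a) :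
  is_cyclotomic a.
Proof.
have [chi [m hX]] := character_table_exists hB.
have [i ->] := ct_eigen hX ha; have [hS hc _] := hB.
exact: (cyclotomic_characters hS hc hX hform hb1 i hb).
Qed.
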